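(* Let $\mathfrak g=\mathfrak q(\infty)$. Every simple module in $\operatorname{Trep}\mathfrak g$ is isomorphic to $V(\lambda,\mu)$ or $\Pi V(\lambda,\mu)$ for some strict bipartition $(\lambda,\mu)$.
   Context: All vector spaces are over $\mathbb C$ and $\mathbb Z_2$-graded; $p(x)$ is the parity of $x$; $\Pi$ is the parity switch; morphisms in module categories preserve parity. The Lie superalgebra: $V=V_0\oplus V_1$ has even basis $\{e_i\}$ and odd basis $\{\bar e_i\}$, $W=W_0\oplus W_1$ has even basis $\{f_i\}$ and odd basis $\{\bar f_i\}$, $i\in\mathbb Z\setminus 0$; the even pairing $W\times V\to\mathbb C$ is given by $(f_i,e_j)=(\bar f_i,\bar e_j)=\delta_{ij}$, all other pairings of basis vectors being $0$. The odd operator $P$ is $Pe_i=\bar e_i$, $P\bar e_i=-e_i$ on $V$ and $Pf_i=\bar f_i$, $P\bar f_i=f_i$ on $W$. $\mathfrak g=\mathfrak q(\infty)$ is the Lie superalgebra of finitary operators $X$ on $V\oplus W$ preserving $V$ and $W$ with $(Xw,v)=-(-1)^{p(w)p(X)}(w,Xv)$ and $[X,P]=0$; it is spanned by $e_i\otimes f_j+\bar e_i\otimes\bar f_j$ and $e_i\otimes\bar f_j+\bar e_i\otimes f_j$, $i,j\in\mathbb Z\setminus 0$ (where $u\otimes w$ acts on $V$ by $v\mapsto (w,v)u$). For $n\ge1$ let $\mathfrak g_n\simeq\mathfrak q(n)$ be the span of these elements with $i,j\in I_n=\{i\ne 0:-\lfloor n/2\rfloor\le i\le\lceil n/2\rceil\}$,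 and let $\mathfrak c_n\simeq\mathfrak q(\infty)$ be the subalgebra (commuting with $\mathfrak g_n$) spanned by these elements with $i,j\notin I_n$. A $\mathfrak g$-module $M$ satisfies the large annihilator condition if $M=\bigcup_n M^{\mathfrak c_n}$. $M$ is integrable if for every $n>0$ its restriction to $\mathfrak g_n$ lifts to a representation of the algebraic supergroup $Q(n)$. $\operatorname{Trep}\mathfrak g$ is the full subcategory of $\mathfrak g$-modules that are integrable, have finite length and satisfy the large annihilator condition. Order $\mathbb Z\setminus0$ by $1\prec2\prec\dots\prec-2\prec-1$. Let $\mathfrak h$ be spanned by the elements $e_i\otimes f_j+\bar e_i\otimes\bar f_j$ and $e_i\otimes\bar f_j+\bar e_i\otimes f_j$ with $i=j$, let $\mathfrak h_0$ be its even part with $\{\varepsilon_i\}$ the system dual to its basis $e_i\otimes f_i+\bar e_i\otimes\bar f_i$; let $\mathfrak n$ be spanned by the elements with $i\prec j$, and $\mathfrak b=\mathfrak h\oplus\mathfrak n$. A strict bipartition is a pair of strict partitions $\lambda=(a_1>\dots>a_k>0)$, $\mu=(a_{-1}>\dots>a_{-l}>0)$ (possibly empty); it is identified with the weight $a_1\varepsilon_1+\dots+a_k\varepsilon_k-a_{-l}\varepsilon_{-l}-\dots-a_{-1}\varepsilon_{-1}$. $V(\lambda,\mu)$ denotes a simple $\mathfrak g$-module with highest weight $(\lambda,\mu)$ with respect to $\mathfrak b$; it is unique up to isomorphism and $\Pi$. *)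

(* Defs.v *)
From HB Require Import structures.
From mathcomp Require Import all_boot all_order all_algebra.
From mathcomp Require Import boolp classical_sets functions.
From mathcomp Require Import freeg.
From mathcomp Require Import zify ring.

Set Implicit Arguments.
Unset Strict Implicit.
Unset Printing Implicit Defensive.

Import Order.TTheory GRing.Theory Num.Theory.
Local Open Scope ring_scope.

Notation idx := {i : int | i != 0}.

Definition in_I (n : nat) (i : idx) : bool :=
  - (n./2)%:Z <= val i <= (uphalf n)%:Z.

Definition I_val (n : nat) (k : 'I_n) : int :=
  if (k < uphalf n)%N then k.+1%:Z else k%:Z - n%:Z.

Fact I_val_neq0 n (k : 'I_n) : I_val k != 0.
Proof.
rewrite /I_val; case: ifP => // _.
by rewrite subr_eq0 eqz_nat neq_ltn ltn_ord.
Qed.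

(* This enumeration of I_n identifies the rows and columns of the n x n matrices
   in Q(n) with I_n. *)
Definition I_enum (n : nat) (k : 'I_n) : idx := exist _ (I_val k) (I_val_neq0 k).

Lemma I_enum_inj n : injective (@I_enum n).
Proof.
move=> k l /(congr1 val); rewrite /= /I_val => e; apply: val_inj => /=.
by move: (ltn_ord k) (ltn_ord l) e; case: ifP => ?; case: ifP => ?; lia.
Qed.

Lemma I_enumP n (i : idx) : reflect (exists k : 'I_n, i = I_enum k) (in_I n i).
Proof.
apply: (iffP idP) => [|[k ->]]; last first.
  rewrite /in_I /= /I_val; move: (ltn_ord k).
  by case: ifP => /=; lia.
case: i => i i0; rewrite /in_I /= => /andP[i1 i2].
have [ip|ineg] : (0 < i) \/ (i < 0) by lia.
- have kn : (`|i|.-1 < n)%N by lia.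
  exists (Ordinal kn); apply: val_inj; rewrite /= /I_val /=.
  by case: ifP; lia.
- have kn : (n - `|i| < n)%N by lia.
  exists (Ordinal kn); apply: val_inj; rewrite /= /I_val /=.
  by case: ifP; lia.
Qed.

(* the order 1 < 2 < ... < -2 < -1 *)
Definition prec (i j : idx) : bool :=
  if (0 < val i) == (0 < val j) then val i < val j else 0 < val i.

Section Queer.
Variable K : fieldType.

Definition sgn (b : bool) : K := (-1) ^+ b.

Definition is_grading (M : lmodType K) (par : bool -> M -> Prop) : Prop :=
  [/\ forall p, par p 0,
      forall p a u v, par p u -> par p v -> par p (a *: u + v),
      forall m, exists m0 m1, [/\ par false m0, par true m1 & m = m0 + m1]
    & forall m, par false m -> par true m -> m = 0].

Record superSpace := SuperSpace {
  ss_sort :> lmodType K;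
  par : bool -> ss_sort -> Prop;
  par_grading : is_grading par }.

(* (i, false) indexes the even basis vectors e_i and f_i, and (i, true) the odd
   ones; V and W are two copies of the same free module. *)
Notation bidx := (idx * bool)%type.
Notation V := {freeg bidx / K}.
Notation W := {freeg bidx / K}.
Notation VW := (V * W)%type.

Definition pairing (w : W) (v : V) : K := \sum_(z <- dom w) coeff z w * coeff z v.

Definition vpar (p : bool) (v : V) : Prop := forall z, z.2 != p -> coeff z v = 0.
Definition vwpar (p : bool) (t : VW) : Prop := vpar p t.1 /\ vpar p t.2.

(* P e_i = bar e_i and P (bar e_i) = - e_i on V, P f_i = bar f_i and P (bar f_i) = f_i
   on W. *)
Definition oddP (t : VW) : VW :=
  (fglift (fun z => << sgn z.2 *g (z.1, ~~ z.2) >> : V) t.1,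
   fglift (fun z => << (z.1, ~~ z.2) >> : W) t.2).

Definition finite_rank (X : VW -> VW) : Prop :=
  exists s : seq VW, forall t, exists c : nat -> K,
    X t = \sum_(i < size s) c i *: s`_i.

(* Homogeneous elements of parity p of q(oo), inside End(V + W). *)
Definition q_hom (p : bool) (X : VW -> VW) : Prop :=
  [/\ (forall a t u, X (a *: t + u) = a *: X t + X u) /\ finite_rank X,
      (forall v, (X (v, 0)).2 = 0) /\ (forall w, (X (0, w)).1 = 0),
      (forall r t, vwpar r t -> vwpar (p (+) r) (X t)),
      (forall r w v, vpar r w ->
         pairing (X (0, w)).2 v = - sgn (r && p) * pairing w (X (v, 0)).1)
    & forall t, X (oddP t) - sgn p *: oddP (X t) = 0].

Definition q_pred : pred (VW -> VW) := fun X => `[<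
  exists X0 X1, [/\ q_hom false X0, q_hom true X1 & X = X0 + X1] >].

Definition supercomm (p r : bool) (X Y : VW -> VW) : VW -> VW :=
  (X \o Y) - sgn (p && r) *: (Y \o X).

Lemma fgliftE (f : bidx -> V) v : fglift f v = \sum_(z <- dom v) coeff z v *: f z.
Proof.
have fB := @lift_is_additive K _ V f.
have f0 : fglift f 0 = 0 by rewrite -[X in fglift f X](subrr 0) fB subrr.
have fD : {morph fglift f : x y / x + y}.
  by move=> x y; rewrite -[y in LHS]opprK fB -[- y]add0r fB f0 add0r opprK.
rewrite -{1}[v]freeg_sumE (big_morph _ fD f0).
by apply: eq_bigr => z _; rewrite liftU.
Qed.

Lemma coeff_fglift (f : bidx -> V) v z :
  coeff z (fglift f v) = \sum_(y <- dom v) coeff y v * coeff z (f y).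
Proof.
by rewrite fgliftE raddf_sum; apply: eq_bigr => y _; rewrite -coeffZ.
Qed.

Lemma sum_dom (F : bidx -> K) (v : V) z :
  (forall y, y != z -> F y = 0) ->
  \sum_(y <- dom v) coeff y v * F y = coeff z v * F z.
Proof.
move=> F0; have [zv|zv] := boolP (z \in dom v).
  rewrite (bigD1_seq z) ?uniq_dom //= big1 ?addr0 // => y yz.
  by rewrite F0 // mulr0.
rewrite coeff_outdom // mul0r big_seq big1 // => y yv.
by rewrite F0 ?mulr0 //; apply: contra zv => /eqP <-.
Qed.

Lemma coeffP (u v : V) : (forall z, coeff z u = coeff z v) -> u = v.
Proof. by move=> uv; apply/eqP/freeg_eqP. Qed.

Lemma coeff_lin z a (u v : V) :
  coeff z (a *: u + v) = a * coeff z u + coeff z v.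
Proof. by rewrite coeffD coeffZ. Qed.

Lemma coeff_oddP1 t z :
  coeff z (oddP t).1 = sgn (~~ z.2) * coeff (z.1, ~~ z.2) t.1.
Proof.
rewrite coeff_fglift (@sum_dom _ _ (z.1, ~~ z.2)) => [|[y b] /= yz].
  by rewrite /= coeffU negbK -surjective_pairing eqxx mulr1 mulrC.
rewrite coeffU; case: eqP => [e|]; last by rewrite mulr0.
by move: yz; rewrite -e /= negbK eqxx.
Qed.

Lemma coeff_oddP2 t z : coeff z (oddP t).2 = coeff (z.1, ~~ z.2) t.2.
Proof.
rewrite coeff_fglift (@sum_dom _ _ (z.1, ~~ z.2)) => [|[y b] /= yz].
  by rewrite /= coeffU negbK -surjective_pairing eqxx !mulr1.
rewrite coeffU; case: eqP => [e|]; last by rewrite mulr0.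
by move: yz; rewrite -e /= negbK eqxx.
Qed.

Lemma oddP_lin a t u : oddP (a *: t + u) = a *: oddP t + oddP u.
Proof.
rewrite [LHS]surjective_pairing; congr pair; apply: coeffP => z.
  by rewrite coeff_lin !coeff_oddP1 coeff_lin mulrDr mulrCA.
by rewrite coeff_lin !coeff_oddP2 coeff_lin.
Qed.

Lemma pairing_linr w a u v :
  pairing w (a *: u + v) = a * pairing w u + pairing w v.
Proof.
rewrite /pairing mulr_sumr -big_split; apply: eq_bigr => z _ /=.
by rewrite coeff_lin; ring.
Qed.

Lemma pairing_over (s : seq bidx) w v : uniq s -> {subset dom w <= s} ->
  pairing w v = \sum_(z <- s) coeff z w * coeff z v.
Proof.
move=> us sub; rewrite [RHS](bigID (mem (dom w))) /= [X in _ + X]big1.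
  rewrite addr0 -big_filter; apply: perm_big; apply: uniq_perm.
  - exact: uniq_dom.
  - exact: filter_uniq.
  - by move=> z; rewrite mem_filter andb_idr // => /sub.
by move=> z zw; rewrite coeff_outdom ?mul0r.
Qed.

Lemma pairing_linl a u w v :
  pairing (a *: u + w) v = a * pairing u v + pairing w v.
Proof.
pose s := undup (dom (a *: u + w) ++ dom u ++ dom w).
have us : uniq s by exact: undup_uniq.
rewrite !(@pairing_over s) //; try by move=> z zz; rewrite mem_undup !mem_cat zz ?orbT.
rewrite mulr_sumr -big_split; apply: eq_bigr => z _ /=.
by rewrite coeff_lin; ring.
Qed.

Lemma pairingU w z : pairing w << z >> = coeff z w.
Proof.
rewrite /pairing (@sum_dom _ _ z) => [|y yz]; first by rewrite coeffU eqxx !mulr1.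
by rewrite coeffU eq_sym (negbTE yz) mulr0.
Qed.

Lemma pairing0 w : pairing w 0 = 0.
Proof. by rewrite /pairing big1 // => z _; rewrite coeff0 mulr0. Qed.

Lemma pair0 v : pairing 0 v = 0.
Proof. by rewrite /pairing dom0 big_nil. Qed.

Lemma pairUing z v : pairing << z >> v = coeff z v.
Proof. by rewrite /pairing domU1 big_seq1 coeffU eqxx !mul1r. Qed.

Lemma pairing_comb w a u b v :
  pairing w (a *: u + b *: v) = a * pairing w u + b * pairing w v.
Proof. by rewrite pairing_linr -[b *: v]addr0 pairing_linr pairing0 addr0. Qed.

Lemma comb_pairing a u b w v :
  pairing (a *: u + b *: w) v = a * pairing u v + b * pairing w v.
Proof. by rewrite pairing_linl -[b *: w]addr0 pairing_linl pair0 addr0. Qed.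

Lemma vpar_lin p a u v : vpar p u -> vpar p v -> vpar p (a *: u + v).
Proof. by move=> pu pv z zp; rewrite coeff_lin pu // pv // mulr0 addr0. Qed.

Lemma vwpar_lin p a t u : vwpar p t -> vwpar p u -> vwpar p (a *: t + u).
Proof. by move=> [? ?] [? ?]; split; apply: vpar_lin. Qed.

Lemma finite_rank_lin a X Y :
  finite_rank X -> finite_rank Y -> finite_rank (a *: X + Y).
Proof.
move=> [s hs] [s' hs']; exists (s ++ s') => t.
have [c cE] := hs t; have [c' c'E] := hs' t.
exists (fun i => if (i < size s)%N then a * c i else c' (i - size s)%N).
rewrite size_cat big_split_ord /=.
have -> : (a *: X + Y) t = a *: X t + Y t by [].
rewrite cE c'E scaler_sumr; congr (_ + _); apply: eq_bigr => i _ /=.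
  by rewrite ltn_ord nth_cat ltn_ord scalerA.
by rewrite ltnNge leq_addr /= addKn nth_cat ltnNge leq_addr /= addKn.
Qed.

Lemma lin0 (X : VW -> VW) :
  (forall a t u, X (a *: t + u) = a *: X t + X u) -> X 0 = 0.
Proof. by move=> lX; have := lX (-1) 0 0; rewrite !scaleN1r oppr0 addr0 addNr. Qed.

Lemma q_hom_lin p a X Y : q_hom p X -> q_hom p Y -> q_hom p (a *: X + Y).
Proof.
move=> [[lX fX] [X2 X1] pX dX cX] [[lY fY] [Y2 Y1] pY dY cY].
have E t : (a *: X + Y) t = a *: X t + Y t by [].
split; first split.
- move=> b t u; rewrite !E lX lY !scalerDr !scalerA addrACA.
  by rewrite [a * b]mulrC.
- exact: finite_rank_lin.
- by split=> x; rewrite E /= ?X2 ?Y2 ?X1 ?Y1 scaler0 addr0.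
- by move=> r t rt; rewrite E; apply: vwpar_lin; [apply: pX|apply: pY].
- move=> r w v rw; rewrite !E /= pairing_linl pairing_linr.
  by rewrite (dX r) // (dY r) //; ring.
- move=> t; rewrite !E oddP_lin scalerDr scalerA [sgn p * a]mulrC -scalerA.
  by rewrite opprD addrACA -scalerBr cX cY scaler0 addr0.
Qed.

Lemma q_hom0 p : q_hom p 0.
Proof.
have E t : (0 : VW -> VW) t = 0 by [].
have z0 r : vwpar r 0 by split=> z _; rewrite coeff0.
split; first split.
- by move=> a t u; rewrite !E scaler0 addr0.
- by exists [::] => t; exists (fun=> 0); rewrite big_ord0.
- by split.
- by move=> r t _; exact: z0.
- by move=> r w v _; rewrite !E /= pairing0 pair0 mulr0.
- by move=> t; rewrite !E (lin0 oddP_lin) scaler0 subr0.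
Qed.

Lemma q_pred_submod : subsemimod_closed q_pred.
Proof.
split; first split.
- apply/asboolP; exists 0, 0; split; [exact: q_hom0|exact: q_hom0|].
  by rewrite addr0.
- move=> X Y /asboolP[X0 [X1 [h0 h1 ->]]] /asboolP[Y0 [Y1 [k0 k1 ->]]].
  apply/asboolP; exists (1 *: X0 + Y0), (1 *: X1 + Y1).
  by split; [exact: q_hom_lin|exact: q_hom_lin|rewrite !scale1r addrACA].
- move=> a X /asboolP[X0 [X1 [h0 h1 ->]]].
  apply/asboolP; exists (a *: X0 + 0), (a *: X1 + 0).
  by split; [exact: (q_hom_lin _ _ (q_hom0 _))|exact: (q_hom_lin _ _ (q_hom0 _))|
    rewrite !addr0 scalerDr].
Qed.

Record q := Q { q_val : VW -> VW; _ : q_pred q_val }.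
HB.instance Definition _ := [isSub for q_val].
HB.instance Definition _ := [Choice of q by <:].
HB.instance Definition _ := GRing.SubChoice_isSubLmodule.Build K (VW -> VW) q_pred q
  q_pred_submod.

Definition qpar (p : bool) (X : q) : Prop := q_hom p (val X).

Lemma q_hom_pred p X : q_hom p X -> q_pred X.
Proof.
by case: p => h; apply/asboolP; [exists 0, X|exists X, 0];
  split; rewrite ?add0r ?addr0 //; exact: q_hom0.
Qed.

Lemma q_hom_supercomm p r X Y :
  q_hom p X -> q_hom r Y -> q_hom (p (+) r) (supercomm p r X Y).
Proof.
have comp s s' A B : q_hom s A -> q_hom s' B ->
    [/\ (forall a t u, (A \o B) (a *: t + u) = a *: (A \o B) t + (A \o B) u) /\
          finite_rank (A \o B),
      (forall v, ((A \o B) (v, 0)).2 = 0) /\ (forall w, ((A \o B) (0, w)).1 = 0),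
      (forall r t, vwpar r t -> vwpar ((s (+) s') (+) r) ((A \o B) t)),
      (forall r w v, vpar r w -> pairing ((A \o B) (0, w)).2 v =
         sgn ((r && s') (+) ((s' (+) r) && s)) * pairing w ((B \o A) (v, 0)).1)
    & forall t, (A \o B) (oddP t) - sgn (s (+) s') *: oddP ((A \o B) t) = 0].
  move=> [[lA [sA fA]] [A2 A1] pA dA cA] [[lB fB] [B2 B1] pB dB cB].
  have vA v : A (v, 0) = ((A (v, 0)).1, 0) by rewrite [LHS]surjective_pairing A2.
  have vB v : B (v, 0) = ((B (v, 0)).1, 0) by rewrite [LHS]surjective_pairing B2.
  have wA v : A (0, v) = (0, (A (0, v)).2) by rewrite [LHS]surjective_pairing A1.
  have wB v : B (0, v) = (0, (B (0, v)).2) by rewrite [LHS]surjective_pairing B1.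
  split; first split.
  - by move=> a t u /=; rewrite lB lA.
  - by exists sA => t; exact: fA.
  - by split=> x /=; [rewrite vB A2|rewrite wB A1].
  - by move=> x t xt /=; rewrite -addbA; apply/pA/pB.
  - move=> x w v xw /=; rewrite wB (dA (s' (+) x)); last first.
      have xt : vwpar x (0, w) by split=> // z _; rewrite coeff0.
      by case: (pB _ _ xt).
    rewrite (vA v) (dB x) // mulrA mulrNN; congr (_ * _).
    by rewrite /sgn -signr_addb addbC.
  - move=> t /=; move/eqP: (cB t); rewrite subr_eq0 => /eqP ->.
    rewrite -[sgn s' *: _]addr0 lA (lin0 lA) addr0.
    move/eqP: (cA (B t)); rewrite subr_eq0 => /eqP ->.
    by rewrite scalerA /sgn -signr_addb addbC subrr.
move=> hX hY; have [[a1 a2] [a3 a4] a5 a6 a7] := comp _ _ _ _ hX hY.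
have [[b1 b2] [b3 b4] b5 b6 b7] := comp _ _ _ _ hY hX.
pose c := - sgn (p && r).
have SE : supercomm p r X Y = c *: (Y \o X) + (X \o Y).
  by rewrite /supercomm /c scaleNr addrC.
have E t : supercomm p r X Y t = c *: (Y \o X) t + (X \o Y) t by rewrite SE.
split; first split.
- move=> a t u; rewrite !E a1 b1 !scalerDr !scalerA addrACA.
  by rewrite [a * c]mulrC.
- by rewrite SE; apply: finite_rank_lin.
- by split=> x; rewrite E /= ?a3 ?b3 ?a4 ?b4 scaler0 addr0.
- move=> x t xt; rewrite E; apply: vwpar_lin; last exact: a5.
  by rewrite [p (+) r]addbC; apply: b5.
- move=> x w v xw; rewrite !E /= pairing_linl pairing_linr.
  rewrite (a6 x) // (b6 x) //= /c /sgn.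
  move: (pairing _ _) (pairing _ _) => m1 m2; clear.
  by case: p r x => [] [] []; rewrite /= ?expr0 ?expr1; ring.
- move=> t; rewrite !E oddP_lin scalerDr scalerA [sgn _ * c]mulrC -scalerA.
  by rewrite opprD addrACA -scalerBr [p (+) r]addbC b7 addbC a7 scaler0 addr0.
Qed.

(* The operator u (x) w for basis vectors u, w: it is v |-> (w, v) u on V, and its
   action on W is the one forced by the invariance of the pairing. *)
Definition vw (u w : bidx) (t : VW) : VW :=
  (coeff w t.1 *: << u >>,
   - sgn (u.2 && (u.2 (+) w.2)) *: (coeff u t.2 *: << w >>)).

(* e_i (x) f_j + bar e_i (x) bar f_j for p = 0 and
   e_i (x) bar f_j + bar e_i (x) f_j for p = 1 *)
Definition ef (p : bool) (i j : idx) : VW -> VW :=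
  vw (i, false) (j, p) + vw (i, true) (j, ~~ p).

Lemma ef_hom p i j : q_hom p (ef p i j).
Proof.
have vw_lin u w a t t' : vw u w (a *: t + t') = a *: vw u w t + vw u w t'.
  rewrite /vw /= !coeff_lin; congr pair => /=.
    by rewrite scalerDl scalerA.
  by rewrite scalerDl scalerDr !scalerA; congr (_ *: _ + _); ring.
have E t : ef p i j t = vw (i, false) (j, p) t + vw (i, true) (j, ~~ p) t by [].
split; first split.
- by move=> a t u; rewrite !E !vw_lin scalerDr addrACA.
- have fr u w : finite_rank (vw u w).
    exists [:: (<< u >>, 0); (0, << w >>)] => t.
    exists (fun k => if k == 0%N then coeff w t.1
                     else - sgn (u.2 && (u.2 (+) w.2)) * coeff u t.2).
    rewrite !big_ord_recl big_ord0 addr0 /vw /=.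
    by congr pair; rewrite /= scaler0 ?addr0 ?add0r // scalerA.
  by rewrite /ef -[vw (i, false) _]scale1r; apply: finite_rank_lin.
- by split=> x; rewrite E /vw /= !coeff0 !scale0r ?scaler0 addr0.
- move=> r t [t1 t2]; rewrite E -[vw _ _ t]scale1r.
  have vp u w : u.2 (+) w.2 = p -> vwpar (p (+) r) (vw u w t).
    move=> uw; split=> z zp; rewrite /= !coeffZ coeffU mul1r.
      case: eqP => [uz|]; last by rewrite mulr0.
      rewrite t1 ?mul0r //; apply: contra zp => /eqP <-; rewrite -uz -uw.
      by case: (u.2); case: (w.2).
    case: eqP => [wz|]; last by rewrite !mulr0.
    rewrite t2 ?mul0r ?mulr0 //; apply: contra zp => /eqP <-; rewrite -wz -uw.
    by case: (u.2); case: (w.2).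
  by apply: vwpar_lin; apply: vp; case: (p).
- move=> r w v rw; rewrite !E /= pairing_comb !scalerA comb_pairing !pairingU !pairUing.
  have rE b : b != r -> coeff (i, b) w = 0 by move=> br; rewrite rw.
  move: (coeff (i, false) w) (coeff (i, true) w) (rE false) (rE true) => a b.
  move: (coeff (j, p) v) (coeff (j, ~~ p) v) => c d; rewrite /sgn; clear.
  by case: r => h0 h1; [rewrite h0|rewrite h1] => //; case: p; rewrite /= ?expr0 ?expr1; ring.
- have E1 t z : coeff z (ef p i j t).1 = coeff (j, p) t.1 * ((i, false) == z)%:R +
      coeff (j, ~~ p) t.1 * ((i, true) == z)%:R.
    by rewrite E coeffD !coeffZ !coeffU !mul1r.
  have E2 t z : coeff z (ef p i j t).2 =
      - (coeff (i, false) t.2 * ((j, p) == z)%:R) -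
      sgn p * (coeff (i, true) t.2 * ((j, ~~ p) == z)%:R).
    rewrite E coeffD !coeffZ !coeffU !mul1r /sgn.
    move: (coeff (i, false) _) (coeff (i, true) _) (_ == z) (_ == z) => x y b c.
    by clear; case: p; rewrite /= ?expr0 ?expr1; ring.
  move=> t; apply/eqP; rewrite subr_eq0; apply/eqP.
  rewrite [LHS]surjective_pairing; congr pair; apply: coeffP => -[k b].
    rewrite coeffZ coeff_oddP1 !E1 !coeff_oddP1 !xpair_eqE /sgn /= negbK.
    move: (i == k) => d; case: (p) => /=;
    move: (coeff (j, false) _) (coeff (j, true) _) => x y; clear;
    by case: b; rewrite /= ?andbF ?andbT ?expr0 ?expr1 ?mulr0n; ring.
  rewrite coeffZ coeff_oddP2 !E2 !coeff_oddP2 !xpair_eqE /sgn /=.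
  move: (coeff (i, false) _) (coeff (i, true) _) (j == k) => x y d; clear.
  by case: b; case: p; rewrite /= ?andbF ?andbT ?expr0 ?expr1 ?mulr0n; ring.
Qed.

Definition EF (p : bool) (i j : idx) : q := Q (q_hom_pred (ef_hom p i j)).

(* The subspace of q(oo) spanned by the EF p i j with B i j; it gives q(oo) itself,
   g_n, c_n, h and n for appropriate B. *)
Definition qspan (B : idx -> idx -> bool) (X : q) : Prop :=
  exists s : seq (K * (bool * idx * idx)),
    all (fun t => B t.2.1.2 t.2.2) s /\
    X = \sum_(t <- s) t.1 *: EF t.2.1.1 t.2.1.2 t.2.2.

Definition c_alg (n : nat) : q -> Prop := qspan (fun i j => ~~ in_I n i && ~~ in_I n j).
Definition n_alg : q -> Prop := qspan prec.

Record qmodule := QModule {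
  qm_space :> superSpace;
  act : q -> qm_space -> qm_space;
  act_linl : forall a X Y m, act (a *: X + Y) m = a *: act X m + act Y m;
  act_linr : forall a X m m', act X (a *: m + m') = a *: act X m + act X m';
  act_par : forall p r X m, qpar p X -> par r m -> par (p (+) r) (act X m);
  act_br : forall p r X Y Z m, qpar p X -> qpar r Y ->
    val Z = supercomm p r (val X) (val Y) ->
    act Z m = act X (act Y m) - sgn (p && r) *: act Y (act X m) }.

Definition is_submodule (M : qmodule) (N : M -> Prop) : Prop :=
  [/\ N 0,
      forall a u v, N u -> N v -> N (a *: u + v),
      forall m0 m1, par false m0 -> par true m1 -> N (m0 + m1) -> N m0 /\ N m1
    & forall X m, N m -> N (act X m)].

Definition simple_module (M : qmodule) : Prop :=
  (exists m : M, m != 0) /\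
  forall N : M -> Prop, is_submodule N ->
    (forall m, N m -> m = 0) \/ (forall m, N m).

Definition finite_length (M : qmodule) : Prop :=
  exists (k : nat) (N : nat -> M -> Prop),
    [/\ forall i, (i <= k)%N -> is_submodule (N i),
        forall m, N 0%N m <-> m = 0,
        forall m, N k m
      & forall i, (i < k)%N ->
        [/\ forall m, N i m -> N i.+1 m,
            exists2 m, N i.+1 m & ~ N i m
          & forall L : M -> Prop, is_submodule L ->
              (forall m, N i m -> L m) -> (forall m, L m -> N i.+1 m) ->
              (forall m, L m -> N i m) \/ (forall m, N i.+1 m -> L m)]].

Definition large_annihilator (M : qmodule) : Prop :=
  forall m : M, exists2 n : nat, (0 < n)%N & forall X, c_alg n X -> act X m = 0.

Definition isomorphic (M N : qmodule) : Prop :=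
  exists f : M -> N,
    [/\ forall a u v, f (a *: u + v) = a *: f u + f v,
        bijective f,
        forall p m, par p m -> par p (f m)
      & forall X m, f (act X m) = act X (f m)].

Lemma is_grading_switch (M : superSpace) :
  @is_grading M (fun p m => par (~~ p) m).
Proof.
case: (par_grading M) => g0 glin gdec gint; split.
- by move=> p; apply: g0.
- by move=> p; apply: glin.
- by move=> m; have [m0 [m1 [? ? ->]]] := gdec m; exists m1, m0; rewrite addrC.
- by move=> m ? ?; apply: gint.
Qed.

Definition Pi_space (M : superSpace) : superSpace :=
  SuperSpace (is_grading_switch M).

Lemma Pi_act_par (M : qmodule) p r (X : q) (m : Pi_space M) :
  qpar p X -> par r m -> @par (Pi_space M) (p (+) r) (act X (m : M)).
Proof. by move=> pX rm /=; rewrite -addbN; apply: act_par. Qed.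

(* X acts on Pi M as on M. The other usual convention, where an odd X acts by the
   opposite, gives a module isomorphic to this one through m |-> (-1)^p(m) m. *)
Definition Pi (M : qmodule) : qmodule :=
  @QModule (Pi_space M) (@act M) (@act_linl M) (@act_linr M)
    (@Pi_act_par M) (@act_br M).

Record superAlg := SuperAlg {
  sa_sort :> algType K;
  sa_par : bool -> sa_sort -> Prop;
  sa_grading : is_grading sa_par;
  sa_par1 : sa_par false 1;
  sa_parM : forall p r a b, sa_par p a -> sa_par r b -> sa_par (p (+) r) (a * b);
  sa_comm : forall p r a b, sa_par p a -> sa_par r b -> a * b = sgn (p && r) *: (b * a) }.

(* Q(n)(A) is the group of invertible even elements, where (S, T) stands
   for the element \sum_(k, l) S k l (x) E k l + T k l (x) F k l of the tensor product of A with the associative superalgebra q(n), where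
   E k l = EF false k l and F k l = EF true k l; the sign in the product below comes
   from (t (x) F) (t' (x) F') = - t t' (x) F F' for t' and F odd. *)
Definition Qmx (n : nat) (A : superAlg) : Type := ('M[A]_n * 'M[A]_n)%type.

Definition Qmul n (A : superAlg) (g h : Qmx n A) : Qmx n A :=
  (g.1 *m h.1 - g.2 *m h.2, g.1 *m h.2 + g.2 *m h.1).

Definition Qone n (A : superAlg) : Qmx n A := (1%:M, 0).

Definition Qeven n (A : superAlg) (g : Qmx n A) : Prop :=
  forall k l, sa_par false (g.1 k l) /\ sa_par true (g.2 k l).

Definition Qgroup n (A : superAlg) (g : Qmx n A) : Prop :=
  Qeven g /\ exists h, [/\ Qeven h, Qmul g h = Qone n A & Qmul h g = Qone n A].

Definition Qmap n (A B : superAlg) (f : {lrmorphism A -> B}) (g : Qmx n A) : Qmx n B :=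
  (map_mx f g.1, map_mx f g.2).

(* The sequence of the (a_k, m_k) represents \sum_k a_k (x) m_k in A (x) M, and
   tensor_eq is equality in A (x) M, expressed by the universal property. *)
Definition tensor (A M : lmodType K) : Type := seq (A * M).

Definition tensor_eq (A M : lmodType K) (s t : tensor A M) : Prop :=
  forall (N : lmodType K) (b : A -> M -> N),
    (forall c a a' m, b (c *: a + a') m = c *: b a m + b a' m) ->
    (forall c a m m', b a (c *: m + m') = c *: b a m + b a m') ->
    \sum_(x <- s) b x.1 x.2 = \sum_(x <- t) b x.1 x.2.

Definition tensor_par (A : superAlg) (M : superSpace) (p : bool) (s : tensor A M) : Prop :=
  forall x, x \in s -> exists r, sa_par r x.1 /\ par (p (+) r) x.2.

Definition tensor_ext (A : superAlg) (M : lmodType K) (f : M -> tensor A M)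
    (s : tensor A M) : tensor A M :=
  flatten [seq [seq (x.1 * y.1, y.2) | y <- f x.2] | x <- s].

(* A representation of Q(n) on M: for every supercommutative superalgebra A, every
   g in Q(n)(A) acts on A (x) M by an even A-linear map, which is determined by its
   restriction Qrho g to M = 1 (x) M; this is an action, and is natural in A. *)
Record Qrep (n : nat) (M : superSpace) := QRep {
  Qrho : forall A : superAlg, Qmx n A -> M -> tensor A M;
  Qrho_lin : forall (A : superAlg) (g : Qmx n A) c m m', Qgroup g ->
    tensor_eq (Qrho g (c *: m + m'))
      ([seq (c *: x.1, x.2) | x <- Qrho g m] ++ Qrho g m');
  Qrho_par : forall (A : superAlg) (g : Qmx n A) p m, Qgroup g -> par p m ->
    exists2 s, tensor_eq (Qrho g m) s & tensor_par p s;
  Qrho1 : forall (A : superAlg) m, tensor_eq (Qrho (Qone n A) m) [:: (1, m)];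
  QrhoM : forall (A : superAlg) (g h : Qmx n A) m, Qgroup g -> Qgroup h ->
    tensor_eq (Qrho (Qmul g h) m) (tensor_ext (Qrho g) (Qrho h m));
  Qrho_nat : forall (A B : superAlg) (f : {lrmorphism A -> B}) (g : Qmx n A) m,
    (forall p a, sa_par p a -> sa_par p (f a)) -> Qgroup g ->
    tensor_eq (Qrho (Qmap f g) m) [seq (f x.1, x.2) | x <- Qrho g m] }.

(* The differential of the representation is the action of g_n: it is read off on
   the points 1 + a E k l (a even of square 0) and 1 + a F k l (a odd). *)
Definition lifts (n : nat) (M : qmodule) (rep : Qrep n M) : Prop :=
  forall (A : superAlg) (a : A) (k l : 'I_n) (m : M),
    (sa_par false a -> a * a = 0 ->
       tensor_eq (Qrho rep (1%:M + a *: delta_mx k l, 0) m)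
         [:: (1, m); (a, act (EF false (I_enum k) (I_enum l)) m)]) /\
    (sa_par true a -> a * a = 0 ->
       tensor_eq (Qrho rep (1%:M, a *: delta_mx k l) m)
         [:: (1, m); (a, act (EF true (I_enum k) (I_enum l)) m)]).

Definition integrable (M : qmodule) : Prop :=
  forall n : nat, (0 < n)%N -> exists rep : Qrep n M, lifts rep.

Definition in_Trep (M : qmodule) : Prop :=
  [/\ integrable M, finite_length M & large_annihilator M].

Definition strict_partition (lam : seq nat) : bool :=
  sorted gtn lam && (0%N \notin lam).

(* The coordinate at eps_i of the weight of (lam, mu). The parts a_{-1} > a_{-2} > ...
   of mu are listed by mu, and Negz k is -(k + 1). *)
Definition bip_weight (lam mu : seq nat) (i : idx) : K :=
  match val i with
  | Posz k => (nth 0%N lam k.-1)%:R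
  | Negz k => - (nth 0%N mu k)%:R
  end.

Definition highest_weight (M : qmodule) (wt : idx -> K) : Prop :=
  exists (p : bool) (v : M),
    [/\ v != 0 /\ par p v,
        forall X, n_alg X -> act X v = 0,
        forall i, act (EF false i i) v = wt i *: v
      & forall N : M -> Prop, is_submodule N -> N v -> forall m, N m].

(* M is one of the simple modules called V(lam, mu), which are isomorphic up to Pi. *)
Definition is_V (lam mu : seq nat) (M : qmodule) : Prop :=
  simple_module M /\ highest_weight M (bip_weight lam mu).

End Queer.

(* Main.v *)
From HB Require Import structures.
Require Import Defs.
From mathcomp Require Import all_boot all_order all_algebra.
From mathcomp Require Import boolp freeg.
From mathcomp Require Import reals.
From mathcomp Require Import complex.
From mathcomp Require Import zify ring.

Set Implicit Arguments.
Unset Strict Implicit.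
Unset Printing Implicit Defensive.

Import Order.TTheory GRing.Theory Num.Theory.
Local Open Scope ring_scope.

(** The even root vectors e_ij act locally nilpotently: for a representation of the
    supergroup, the orbit of m under the one-parameter group 1 + t e_ij is polynomial in
    t, and its Taylor coefficients are e_ij ^ k m / k!, by the differential of the
    representation ([root_vector_nilpotent]). Since almost all h_j kill a given
    vector, every h_i acts on it as h_i - h_j for some j, so the theory of sl(2) gives
    integral eigenvalues, a weight vector f killed by some c_n
    ([weight_vector_exists]), and the invariance of the set of weights under
    permutations of the indices ([weight_swap]).

    The main point is that the weights nu of a simple module M have bounded mass, the
    sum of the |nu_i|. Let J be the index set of g_n, and consider the parabolic
    subalgebra with Levi factor g_n + c_n. Its radical is supercommutative, and because
    c_n kills f, the nilpotency of single root vectors on f spreads by polarization to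
    all of the radical: products of R of its elements kill f, and then all of U(g_n) f
    ([polarize], [wnilp_cross]). Hence M is spanned by a elements of the opposite
    radical applied to b <= R elements of the radical applied to U(g_n) f, whose weights
    are bounded; the sum of the nu_i over J grows with b and decreases with a, so it is
    bounded above ([gen_bound]). The Chevalley involution exchanges the two radicals and bounds
    it below, whence a is bounded too ([weights_bounded]).

    Now choose among the weights of maximal mass p one that maximizes a linear
    functional strictly decreasing on the first and the last p indices. By the
    invariance under permutations it is decreasing along the order of the indices and
    vanishes in the middle, and adding a positive root increases the mass, or the
    functional at constant mass; so its weight vectors are highest weight vectors ([maximal_weight]).
    Two equal nonzero coordinates are impossible, as the root vectors of the
    corresponding q(2) would act by zero on the weight space ([singular_strict]). This is a strict bipartition.

    For the uniqueness, let M and V be simple with the same highest weight. The odd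
    Cartan elements generate a Clifford algebra on the highest weight space; a vector
    killed by a maximal isotropic subspace (a pure one) exists in both spaces, and up to Pi the two
    have the same parity. The submodule of M + V generated by such a
    pair (u, u') has highest weight space generated by (u, u') over the Clifford algebra
    ([verma_top]), and purity shows that (0, u') is not in it ([spinors_pure]). It is
    therefore a proper submodule, and it is the graph of an isomorphism
    ([graph_isomorphism]). *)

(** * The Lie superalgebra: basis and brackets *)

Section QueerBasis.
Variable K : fieldType.
Notation V := {freeg (idx * bool) / K}.
Notation VW := (V * V)%type.

Lemma coeff_ef1 p i j (t : VW) z : coeff z (ef p i j t).1 =
  coeff (j, p) t.1 * ((i, false) == z)%:R + coeff (j, ~~ p) t.1 * ((i, true) == z)%:R.
Proof. by rewrite /ef /= coeffD !coeffZ !coeffU !mul1r. Qed.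

Lemma coeff_ef2 p i j (t : VW) z : coeff z (ef p i j t).2 =
  - (coeff (i, false) t.2 * ((j, p) == z)%:R) -
  sgn K p * (coeff (i, true) t.2 * ((j, ~~ p) == z)%:R).
Proof.
rewrite /ef /= coeffD !coeffZ !coeffU !mul1r /sgn.
move: (coeff (i, false) _) (coeff (i, true) _) (_ == z) (_ == z) => x y b c.
by clear; case: p; rewrite /= ?expr0 ?expr1; ring.
Qed.

Lemma ef_supercomm p r i j k l (t : VW) :
  supercomm p r (ef p i j) (ef r k l) t =
  (j == k)%:R *: ef (p (+) r) i l t -
  (sgn K (p && r) * (i == l)%:R) *: ef (p (+) r) k j t.
Proof.
have -> : supercomm p r (ef p i j) (ef r k l) t =
  ef p i j (ef r k l t) - sgn K (p && r) *: ef r k l (ef p i j t) by [].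
rewrite -[X in X - _]scale1r.
have comb1 (a b : K) (x y : VW) : (a *: x - b *: y).1 = a *: x.1 - b *: y.1 by [].
have comb2 (a b : K) (x y : VW) : (a *: x - b *: y).2 = a *: x.2 - b *: y.2 by [].
rewrite [LHS]surjective_pairing [RHS]surjective_pairing.
congr pair; apply: coeffP => -[m b]; rewrite (comb1, comb2) (comb1, comb2);
  rewrite !(coeffB, coeffZ) !(coeff_ef1, coeff_ef2) !xpair_eqE /sgn.
  rewrite [k == j]eq_sym.
  move: (i == m) (j == k) (i == l) (k == m) => d1 d2 d3 d4.
  case: p; case: r; case: b; rewrite /= ?andbF ?andbT ?expr0 ?expr1 ?mulr0n;
  move: (coeff (l, _) t.1) (coeff (l, _) t.1) (coeff (j, _) t.1) (coeff (j, _) t.1) => x y z w;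
  by ring.
rewrite [l == i]eq_sym.
move: (j == m) (j == k) (i == l) (l == m) => d1 d2 d3 d4.
case: p; case: r; case: b; rewrite /= ?andbF ?andbT ?expr0 ?expr1 ?mulr0n;
move: (coeff (i, _) t.2) (coeff (i, _) t.2) (coeff (k, _) t.2) (coeff (k, _) t.2) => x y z w;
by ring.
Qed.

Lemma q_hom_linV p (X : VW -> VW) v z : q_hom p X ->
  coeff z (X (v, 0)).1 = \sum_(y <- dom v) coeff y v * coeff z (X (<< y >>, 0)).1.
Proof.
move=> [[lX _] _ _ _ _].
have X0 := lin0 lX.
pose f := fun v => X (v, 0).
have fL a x y : f (a *: x + y) = a *: f x + f y.
  by rewrite -lX /f; congr X; congr pair; rewrite /= scaler0 addr0.
have fD : {morph f : x y / x + y} by move=> x y; rewrite -[x]scale1r fL !scale1r.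
have fZ a x : f (a *: x) = a *: f x by rewrite -[a *: x]addr0 fL /f X0 addr0.
rewrite -/(f v) -{1}[v]freeg_sumE (big_morph f fD X0).
rewrite (big_morph (fun t : VW => t.1) (id1 := 0) (op1 := +%R)) //.
rewrite raddf_sum /=; apply: eq_bigr => y _.
have -> : << coeff y v *g y >> = coeff y v *: << y >> :> V.
  by apply: coeffP => x; rewrite coeffZ !coeffU mul1r.
by rewrite fZ /= coeffZ.
Qed.

Lemma vparU (z : idx * bool) : vpar z.2 (<< z >> : V).
Proof. by move=> y yz; rewrite coeffU; case: eqP => [zy|_]; [rewrite zy eqxx in yz|rewrite mulr0]. Qed.

Lemma vpar0 b : vpar b (0 : V).
Proof. by move=> y _; rewrite coeff0. Qed.

Lemma q_hom_dual p (X : VW -> VW) z y : q_hom p X ->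
  coeff z (X (0, << y >>)).2 = - sgn K (y.2 && p) * coeff y (X (<< z >>, 0)).1.
Proof.
by move=> [_ _ _ dX _]; rewrite -pairingU (dX y.2) ?pairUing //; exact: vparU.
Qed.

(** The pairing determines X on W from X on V. On V, parity leaves two blocks of the
    matrix of X, and the supercommutation with P determines one from the other. *)
Lemma q_hom_eq0 p (X : VW -> VW) : q_hom p X ->
  (forall i j, coeff (i, false) (X (<< (j, p) >>, 0)).1 = 0) -> forall t, X t = 0.
Proof.
move=> hX X0; have [[lX _] [X2 X1] pX dX cX] := hX.
have pXU j b i b' : b' != p (+) b -> coeff (i, b') (X (<< (j, b) >>, 0)).1 = 0.
  move=> bb; have vb : vwpar b (<< (j, b) >> : V, 0 : V).
    by split; [exact: (@vparU (j, b))|exact: vpar0].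
  by have [h _] := pX _ _ vb; apply: h.
have XU y z : coeff z (X (<< y >>, 0)).1 = 0.
  case: y z => [j b] [i b'].
  have [b'E|/pXU-> //] := eqVneq b' (p (+) b).
  have [bp|bp] := eqVneq b p; first by rewrite b'E bp addbb X0.
  have {b'E bp} [-> ->] : b = ~~ p /\ b' = true.
    by rewrite b'E; case: (p) bp; case: (b).
  have /eqP := cX (<< (j, p) >>, 0); rewrite subr_eq0 => /eqP /(congr1 (fun t => coeff (i, true) t.1)).
  have -> : oddP (<< (j, p) >> : V, 0 : V) = sgn K p *: (<< (j, ~~ p) >>, 0).
    rewrite [LHS]surjective_pairing; congr pair; apply: coeffP => -[k c].
      rewrite coeff_oddP1 coeffZ !coeffU !mul1r !xpair_eqE /= /sgn.
      by case: (j == k); case: (p); case: (c); rewrite /= ?mulr0 ?mulr1.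
    by rewrite coeff_oddP2 scaler0 /= !coeff0.
  rewrite -[sgn K p *: (_, _)]addr0 lX (lin0 lX) addr0 /= !coeffZ coeff_oddP1 /= X0 !mulr0.
  by move/eqP; rewrite mulf_eq0 /sgn signr_eq0 /= => /eqP.
have XV v : X (v, 0) = 0.
  rewrite [LHS]surjective_pairing X2; congr pair; apply: coeffP => z.
  by rewrite (q_hom_linV _ _ hX) coeff0 big1 // => y _; rewrite XU mulr0.
have XW w : X (0, w) = 0.
  rewrite [LHS]surjective_pairing X1; congr pair; apply: coeffP => z.
  have par_comp b : vpar b (fglift (fun z : idx * bool => if z.2 == b then << z >> else 0 : V) w).
    move=> y yb; rewrite coeff_fglift big1 // => x _.
    case: ifP => xb; last by rewrite coeff0 mulr0.
    rewrite coeffU; case: eqP => [xy|_]; last by rewrite !mulr0.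
    by rewrite -xy xb in yb.
  have wE : w = 1 *: fglift (fun z : idx * bool => if z.2 == false then << z >> else 0 : V) w +
                fglift (fun z : idx * bool => if z.2 == true then << z >> else 0 : V) w.
    rewrite scale1r; apply: coeffP => y; rewrite coeffD !coeff_fglift -big_split /=.
    rewrite -{1}[w]freeg_sumE raddf_sum; apply: eq_bigr => x _ /=.
    rewrite -mulrDr -coeffD; case: (x.2) => /=; rewrite ?add0r ?addr0 !coeffU //; by ring.
  have fL (x y : V) : X (0, 1 *: x + y) = 1 *: X (0, x) + X (0, y).
    by rewrite -lX; congr X; congr pair; rewrite /= scaler0 addr0.
  rewrite coeff0 wE fL scale1r /= coeffD -!pairingU.
  by rewrite (dX false) // (dX true) // XV !pairing0 !mulr0 addr0.
move=> [v w].
have -> : (v, w) = 1 *: (v, 0) + (0, w) by rewrite scale1r; congr pair; rewrite /= ?addr0 ?add0r.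
by rewrite lX XV XW scaler0 addr0.
Qed.

(** Finite rank bounds the rows of the matrix of X on V; the columns are the rows of
    the transposed matrix, which describes X on W. *)
Lemma q_hom_supp p (X : VW -> VW) : q_hom p X ->
  exists D : seq idx, uniq D /\
    forall i j, ~~ ((i \in D) && (j \in D)) -> coeff (i, false) (X (<< (j, p) >>, 0)).1 = 0.
Proof.
move=> hX; have [[_ [s fX]] _ _ _ _] := hX.
pose D := undup [seq z.1 | z <- flatten [seq dom t.1 ++ dom t.2 | t <- s]].
have DP t z : t \in s -> z.1 \notin D -> coeff z t.1 = 0 /\ coeff z t.2 = 0.
  move=> ts; rewrite mem_undup => zD; split; apply: coeff_outdom;
  apply: contra zD => zt; apply/mapP; exists z => //; apply/flattenP;
  by exists (dom t.1 ++ dom t.2); rewrite ?mem_cat ?zt ?orbT //; apply/mapP; exists t.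
have XD t z : z.1 \notin D -> coeff z (X t).1 = 0 /\ coeff z (X t).2 = 0.
  move=> zD; have [c ->] := fX t.
  rewrite (big_morph (fun t : VW => t.1) (id1 := 0) (op1 := +%R)) //.
  rewrite (big_morph (fun t : VW => t.2) (id1 := 0) (op1 := +%R)) //.
  rewrite !raddf_sum /=; split; apply: big1 => k _;
  by have [h1 h2] := DP s`_k z (mem_nth _ (ltn_ord k)) zD; rewrite coeffZ ?h1 ?h2 mulr0.
exists D; split; first exact: undup_uniq.
move=> i j; rewrite negb_and => /orP[iD|jD]; first by case: (XD (<< (j, p) >>, 0) (i, false)).
have [_] := XD (0, << (i, false) >>) (j, p) jD.
by rewrite (q_hom_dual _ _ hX) /sgn /= expr0 mulN1r => /eqP; rewrite oppr_eq0 => /eqP.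
Qed.

Lemma sum_delta (T : eqType) (D : seq T) (c : T -> T -> K) i j : uniq D ->
  (~~ ((i \in D) && (j \in D)) -> c i j = 0) ->
  \sum_(k <- D) \sum_(l <- D) c k l * ((k == i)%:R * (l == j)%:R) = c i j.
Proof.
move=> uD cD.
have [ijD|ijD] := boolP ((i \in D) && (j \in D)); last first.
  rewrite (cD ijD) big1_seq // => k /andP[_ kD]; rewrite big1_seq // => l /andP[_ lD].
  case: eqP ijD => [<-|]; last by rewrite mul0r mulr0.
  by case: eqP => [<-|]; rewrite ?mulr0 // kD lD.
have /andP[iD jD] := ijD.
rewrite (bigD1_seq i) //= (bigD1_seq j) //= !eqxx !mulr1.
rewrite big1 ?addr0 => [|l /negbTE lj]; last by rewrite lj !mulr0.
rewrite big1 ?addr0 // => k /negbTE ki.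
by rewrite big1 // => l _; rewrite ki mul0r mulr0.
Qed.

Lemma EF_span (X : q K) : qspan (fun _ _ => true) X.
Proof.
have homspan p (Y : VW -> VW) (hY : q_hom p Y) : qspan (fun _ _ => true) (Q (q_hom_pred hY)).
  have [D [uD DP]] := q_hom_supp hY.
  pose c i j := coeff (i, false) (Y (<< (j, p) >>, 0)).1.
  pose s := [seq (c i j, (p, i, j)) | i <- D, j <- D].
  exists s; split; first by apply/allP => t _.
  pose Z := \sum_(t <- s) t.1 *: EF K t.2.1.1 t.2.1.2 t.2.2.
  have hZ : q_hom p (val Z).
    rewrite /Z /s big_allpairs_dep /=.
    elim/big_ind: _ => [|u v hu hv|i _]; first exact: q_hom0.
      by have := q_hom_lin 1 hu hv; rewrite scale1r.
    elim/big_ind: _ => [|u v hu hv|j _]; first exact: q_hom0.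
      by have := q_hom_lin 1 hu hv; rewrite scale1r.
    by have := q_hom_lin (c i j) (ef_hom _ p i j) (q_hom0 _ p); rewrite addr0.
  have cZ i j : coeff (i, false) (val Z (<< (j, p) >>, 0)).1 = c i j.
    pose g (Y : q K) := coeff (i, false) (val Y (<< (j, p) >>, 0)).1.
    have gD : {morph g : x y / x + y} by move=> x y; rewrite /g /= coeffD.
    have g0 : g 0 = 0 by rewrite /g /= coeff0.
    rewrite -/(g Z) /Z (big_morph g gD g0) /s big_allpairs_dep /=.
    have gE k l : g (c k l *: EF K p k l) = c k l * ((k == i)%:R * (l == j)%:R).
      have -> : g (c k l *: EF K p k l) =
          c k l * coeff (i, false) (ef p k l (<< (j, p) >>, 0)).1 by rewrite -coeffZ.
      rewrite coeff_ef1 /= !coeffU !xpair_eqE /= [j == l]eq_sym.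
      by case: (p); rewrite /= ?andbT ?andbF ?mulr0n; ring.
    rewrite (eq_bigr (fun k => \sum_(l <- D) c k l * ((k == i)%:R * (l == j)%:R))) => [|k _].
      2: by apply: eq_bigr => l _; exact: gE.
    by apply: sum_delta => // ijD; exact: DP.
  apply/eqP; rewrite -subr_eq0; apply/eqP/val_inj/funext.
  apply: (@q_hom_eq0 p).
    by rewrite /= addrC -scaleN1r; apply: q_hom_lin.
  by move=> i j; rewrite /= coeffB cZ subrr.
have /asboolP[X0 [X1 [h0 h1 XE]]] := valP X.
have [s0 [_ E0]] := homspan _ _ h0; have [s1 [_ E1]] := homspan _ _ h1.
exists (s0 ++ s1); split; first by apply/allP => t _.
by rewrite big_cat /= -E0 -E1; apply: val_inj.
Qed.

End QueerBasis.

(** * Local nilpotency of the even root vectors *)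

Section Dual.
Variable K : fieldType.

(** Dual numbers over the polynomials in t: (p, q) stands for p + q eps with
    eps ^ 2 = 0. *)
Definition dual : Type := ({poly K} * {poly K})%type.
HB.instance Definition _ := GRing.Lmodule.copy dual ({poly K} * {poly K})%type.

Definition dual_mul (x y : dual) : dual := (x.1 * y.1, x.1 * y.2 + x.2 * y.1).

Lemma dual_eq (x y : dual) : x.1 = y.1 -> x.2 = y.2 -> x = y.
Proof. by case: x y => [a b] [c d] /= -> ->. Qed.

Fact dual_mulA : associative dual_mul.
Proof. by move=> [a b] [c d] [e f]; congr pair => /=; ring. Qed.
Fact dual_mulC : commutative dual_mul.
Proof. by move=> [a b] [c d]; congr pair => /=; ring. Qed.
Fact dual_mul1 : left_id ((1, 0) : dual) dual_mul.
Proof. by move=> [a b]; rewrite /dual_mul /=; congr pair; ring. Qed.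
Fact dual_mulDl : left_distributive dual_mul +%R.
Proof. by move=> [a b] [c d] [e f]; congr pair => /=; ring. Qed.
Fact dual_neq0 : ((1, 0) : dual) != 0.
Proof. by apply/eqP => -[/eqP]; rewrite oner_eq0. Qed.
HB.instance Definition _ := GRing.Zmodule_isComNzRing.Build dual
  dual_mulA dual_mulC dual_mul1 dual_mulDl dual_neq0.
Fact dual_scaleAl (a : K) (u v : dual) : a *: (u * v) = (a *: u : dual) * v.
Proof.
case: u v => [u1 u2] [v1 v2]; apply: dual_eq; [exact: scalerAl|].
by rewrite /= scalerDr !scalerAl.
Qed.
HB.instance Definition _ := GRing.Lmodule_isLalgebra.Build K dual dual_scaleAl.
HB.instance Definition _ := GRing.Lalgebra_isComAlgebra.Build K dual.

Definition dual_const (p : {poly K}) : dual := (p, 0).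
(** The substitution of t + eps for t. *)
Definition taylor (p : {poly K}) : dual := (p, p^`()).
Definition at0 (p : {poly K}) : {poly K} := (p`_0)%:P.

Fact dual_const_linear : linear dual_const.
Proof. by move=> a p q; apply: dual_eq; rewrite //= scaler0 addr0. Qed.
Fact dual_const_monoid : monoid_morphism dual_const.
Proof. by split=> // p q; apply: dual_eq; rewrite //= mulr0 mul0r addr0. Qed.
HB.instance Definition _ := GRing.isLinear.Build K {poly K} dual *:%R dual_const dual_const_linear.
HB.instance Definition _ := GRing.isMonoidMorphism.Build {poly K} dual dual_const dual_const_monoid.

Fact taylor_linear : linear taylor.
Proof. by move=> a p q; apply: dual_eq; rewrite //= derivD derivZ. Qed.
Fact taylor_monoid : monoid_morphism taylor.
Proof. by split=> [|p q]; apply: dual_eq; rewrite //= ?derivC // derivM addrC. Qed.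
HB.instance Definition _ := GRing.isLinear.Build K {poly K} dual *:%R taylor taylor_linear.
HB.instance Definition _ := GRing.isMonoidMorphism.Build {poly K} dual taylor taylor_monoid.

Fact at0_linear : linear at0.
Proof. by move=> a p q; rewrite /at0 coefD coefZ polyCD polyCM mul_polyC. Qed.
Fact at0_monoid : monoid_morphism at0.
Proof. by split=> [|p q]; rewrite /at0 ?coef1 // coef0M polyCM. Qed.
HB.instance Definition _ := GRing.isLinear.Build K {poly K} {poly K} *:%R at0 at0_linear.
HB.instance Definition _ := GRing.isMonoidMorphism.Build {poly K} {poly K} at0 at0_monoid.

(** A commutative algebra is a supercommutative one without odd part. *)
Definition even_par (A : lmodType K) (p : bool) (a : A) : Prop := if p then a = 0 else True.

Fact even_par_grading (A : lmodType K) : is_grading (@even_par A).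
Proof.
split=> [[]|[] a u v //= -> ->|m|m _] //; first by rewrite scaler0 addr0.
by exists m, 0; rewrite addr0.
Qed.

Fact even_parM (A : comAlgType K) p r (a b : A) :
  even_par p a -> even_par r b -> even_par (p (+) r) (a * b).
Proof. by case: p => [->|_]; case: r => [->|_]; rewrite ?mul0r ?mulr0. Qed.

Fact even_par_comm (A : comAlgType K) p r (a b : A) :
  even_par p a -> even_par r b -> a * b = sgn K (p && r) *: (b * a).
Proof.
rewrite /sgn mulrC; case: p => [->|_]; case: r => [->|_];
by rewrite ?mulr0 ?mul0r ?expr0 ?scaler0 ?scale1r.
Qed.

Definition even_alg (A : comAlgType K) : superAlg K :=
  @SuperAlg K A (@even_par A) (even_par_grading A) I (@even_parM A) (@even_par_comm A).

End Dual.

Section Unipotent.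
Variables (K : fieldType) (A : superAlg K) (n : nat) (k l : 'I_n).
Hypothesis kl : k != l.

Definition unip (a : A) : Qmx n A := (1%:M + a *: delta_mx k l, 0).

Lemma unipM a b : Qmul (unip a) (unip b) = unip (a + b).
Proof.
rewrite /Qmul /unip /= !mulmx0 !mul0mx subr0 addr0; congr pair.
rewrite mulmxDl mul1mx mulmxDr mulmx1 scalerDl [RHS]addrA addrAC -!addrA; congr (_ + (_ + _)).
suff -> : (a *: delta_mx k l) *m (b *: delta_mx k l) = 0 :> 'M_n by rewrite addr0.
apply/matrixP => i j; rewrite !mxE big1 // => m _; rewrite !mxE.
have [->|] := eqVneq m l; last by rewrite andbF mulr0 mul0r.
by rewrite [l == k]eq_sym (negbTE kl) !mulr0.
Qed.

Lemma unip_even a : sa_par false a -> Qeven (unip a).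
Proof.
move=> a0 i j; have [p0 plin _ _] := sa_grading A.
rewrite !mxE; split => //.
have -> : (i == j)%:R + a * ((i == k) && (j == l))%:R =
    ((i == j)%:R : K) *: (1 : A) + (((i == k) && (j == l))%:R *: a + 0).
  by rewrite addr0; case: eqP; case: (_ && _); rewrite ?scale1r ?scale0r ?mulr1 ?mulr0.
apply: (plin); first exact: sa_par1.
by apply: (plin).
Qed.

Lemma unip_group a : sa_par false a -> Qgroup (unip a).
Proof.
move=> a0; split; first exact: unip_even.
have [p0 plin _ _] := sa_grading A.
exists (unip (- a)); rewrite !unipM subrr addNr.
by split; [apply: unip_even|rewrite /unip scale0r addr0..]; rewrite // -[- a]addr0 -scaleN1r; apply: (plin).
Qed.

End Unipotent.

Lemma Qmap_unip (K : fieldType) (A B : superAlg K) (f : {lrmorphism A -> B}) n (k l : 'I_n) a :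
  Qmap f (unip k l a) = unip k l (f a).
Proof.
rewrite /Qmap /unip /=; congr pair; apply/matrixP => i j; rewrite !mxE ?rmorph0 //.
by rewrite rmorphD rmorphM !rmorph_nat.
Qed.

Section LocallyNilpotent.
Variables (K : fieldType) (M : qmodule K) (n : nat) (rep : Qrep n M).
Hypothesis Hlift : lifts rep.

Definition tcoef (k : nat) (s : tensor {poly K} M) : M := \sum_(x <- s) x.1`_k *: x.2.

(** With w_j the coefficient of t ^ j in the action of 1 + t e_kl on m, the identity
    1 + (t + eps) e_kl = (1 + eps e_kl) (1 + t e_kl) gives (j + 1) w_(j + 1) = e_kl w_j.
    As w_0 = m, the vector e_kl ^ j m is j! w_j, which vanishes for large j. *)
Lemma root_vector_nilpotent (k l : 'I_n) (m : M) : k != l ->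
  exists r, iter r (act (EF K false (I_enum k) (I_enum l))) m = 0.
Proof.
move=> kl; set e := act _.
have elin : forall a u v, e (a *: u + v) = a *: e u + e v by move=> *; apply: act_linr.
have e0 : e 0 = 0 by have := elin (-1) 0 0; rewrite !scaleN1r oppr0 addr0 addNr.
have eZ a u : e (a *: u) = a *: e u by rewrite -[a *: u]addr0 elin e0 addr0.
have eD : {morph e : u v / u + v} by move=> u v; rewrite -[u]scale1r elin !scale1r.
pose A := even_alg {poly K}; pose B := even_alg (dual K).
have parf (C D : comAlgType K) (f : {lrmorphism even_alg C -> even_alg D}) p a :
    sa_par p a -> sa_par p (f a) by case: p => //= ->; exact: raddf0.
pose f0 : {lrmorphism A -> A} := @at0 K.
pose fT : {lrmorphism A -> B} := @taylor K.
pose fC : {lrmorphism A -> B} := @dual_const K.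
pose gX := unip k l ('X : A); pose s := Qrho rep gX m.
have GX : Qgroup gX by exact: unip_group.
have sat0 : tcoef 0 s = m.
  have := @Qrho_nat _ _ _ rep A A f0 gX m (@parf _ _ _) GX.
  rewrite Qmap_unip /unip /= {1}/at0 coefX /= polyC0 scale0r addr0 => nat0.
  pose b (a : A) (x : M) : M := (a : {poly K})`_0 *: x.
  have bl c a a' x : b (c *: a + a') x = c *: b a x + b a' x.
    by rewrite /b coefD coefZ scalerDl scalerA.
  have br c a x x' : b a (c *: x + x') = c *: b a x + b a x'.
    by rewrite /b scalerDr !scalerA mulrC.
  have := Qrho1 rep m bl br; rewrite (nat0 _ b bl br) big_map big_seq1 /b /= coef1 scale1r => <-.
  by apply: eq_bigr => x _; rewrite /= /at0 coefC.
have rec j : j.+1%:R *: tcoef j.+1 s = e (tcoef j s).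
  pose eps : B := ((0, 1) : dual K).
  pose cX := unip k l (dual_const 'X : B).
  have epsg : Qgroup (unip k l eps) by exact: unip_group.
  have cXg : Qgroup cX by exact: unip_group.
  have natT := @Qrho_nat _ _ _ rep A B fT gX m (@parf _ _ _) GX.
  have natC := @Qrho_nat _ _ _ rep A B fC gX m (@parf _ _ _) GX.
  have mulE := QrhoM rep m epsg cXg.
  have TE : Qmap fT gX = Qmul (unip k l eps) cX.
    have -> : Qmul (unip k l eps) cX = unip k l (eps + dual_const 'X) by exact: unipM.
    have <- : taylor 'X = ((0, 1) : dual K) + dual_const 'X.
      by apply: dual_eq; rewrite /= ?add0r // derivX addr0.
    exact: Qmap_unip.
  rewrite TE in natT; rewrite Qmap_unip -/cX in natC.
  pose b (a : B) (x : M) : M := (a : dual K).2`_j *: x.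
  have bl c a a' x : b (c *: a + a') x = c *: b a x + b a' x.
    by rewrite /b /= coefD coefZ scalerDl scalerA.
  have br c a x x' : b a (c *: x + x') = c *: b a x + b a x'.
    by rewrite /b scalerDr !scalerA mulrC.
  have := natT _ b bl br; rewrite big_map /= (mulE _ b bl br).
  rewrite /tensor_ext big_flatten /= big_map.
  under eq_bigr => x _.
    rewrite big_map /=.
    have -> : \sum_(y <- Qrho rep (unip k l eps) x.2) b (x.1 * y.1) y.2 =
        b (x.1 * 1) x.2 + b (x.1 * eps) (e x.2).
      have [/(_ I _) h _] := Hlift eps k l x.2.
      have /h {}h : eps * eps = 0 by apply: dual_eq; rewrite /= ?mul0r ?mulr0 ?addr0.
      rewrite (h _ (fun a => b (x.1 * a))); first by rewrite big_cons big_seq1.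
        by move=> c a a' y; rewrite mulrDr -scalerAr bl.
      by move=> c a y y'; rewrite br.
    over.
  rewrite (natC _ (fun a y => b (a * 1) y + b (a * eps) (e y))).
  - rewrite big_map => E.
    have -> : j.+1%:R *: tcoef j.+1 s = \sum_(x <- s) b (taylor x.1) x.2.
      rewrite /tcoef scaler_sumr; apply: eq_bigr => x _.
      by rewrite /b /= coef_deriv scalerA mulr_natl.
    rewrite -E /tcoef (big_morph e eD e0); apply: eq_bigr => x _.
    rewrite /b /= ?mulr0 ?mul0r !mulr1 ?addr0.
    by rewrite coef0 scale0r add0r eZ.
  - move=> c a a' y; rewrite !mulrDl -!scalerAl !bl scalerDr; exact: addrACA.
  - move=> c a y y'; rewrite elin !br scalerDr; exact: addrACA.
have sE j : j`!%:R *: tcoef j s = iter j e m.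
  elim: j => [|j IH]; first by rewrite sat0 fact0 scale1r.
  by rewrite iterS -IH factS mulnC natrM -scalerA rec eZ.
pose r := (\max_(x <- s) size (x.1 : {poly K}))%N; exists r; rewrite -(sE r).
rewrite /tcoef big_seq big1 ?scaler0 // => x xs; rewrite nth_default ?scale0r //.
exact: (@leq_bigmax_seq _ s xpredT (fun x => size (x.1 : {poly K}))).
Qed.
End LocallyNilpotent.

(** * Spans and representations of sl(2) *)

Section Span.
Variables (K : fieldType) (U : lmodType K).

Definition subspace (N : U -> Prop) : Prop :=
  N 0 /\ forall a u v, N u -> N v -> N (a *: u + v).

Definition lspan (Q : U -> Prop) (m : U) : Prop :=
  exists s : seq U, (forall y, y \in s -> Q y) /\ m = \sum_(y <- s) y.

Definition scalable_pred (Q : U -> Prop) : Prop := forall a y, Q y -> Q (a *: y).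

Lemma subspaceZ N : subspace N -> scalable_pred N.
Proof. by move=> [N0 Nl] a y Ny; rewrite -[a *: y]addr0; apply: Nl. Qed.

Lemma subspaceD N u v : subspace N -> N u -> N v -> N (u + v).
Proof. by move=> [N0 Nl] Nu Nv; rewrite -[u]scale1r; apply: Nl. Qed.

Lemma subspaceB N u v : subspace N -> N u -> N v -> N (u - v).
Proof. by move=> hN Nu Nv; rewrite -scaleN1r; apply: subspaceD => //; apply: subspaceZ. Qed.

Lemma lspan0 Q : lspan Q 0.
Proof. by exists [::]; rewrite big_nil. Qed.

Lemma lspan_in Q (y : U) : Q y -> lspan Q y.
Proof. by exists [:: y]; rewrite big_seq1; split=> // z /[1!inE] /eqP ->. Qed.

Lemma lspanD Q u v : lspan Q u -> lspan Q v -> lspan Q (u + v).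
Proof.
move=> [s [Qs ->]] [t [Qt ->]]; exists (s ++ t); rewrite big_cat; split=> // y.
by rewrite mem_cat => /orP[/Qs|/Qt].
Qed.

Lemma lspan_ind (Q N : U -> Prop) : subspace N -> (forall y, Q y -> N y) ->
  forall m, lspan Q m -> N m.
Proof.
move=> hN QN m [s [Qs ->]]; elim: s Qs => [|y s IH] Qs; rewrite ?big_nil ?big_cons.
  by case: hN.
by apply: subspaceD => //; [apply/QN/Qs/mem_head|apply: IH => z zs; apply: Qs; rewrite inE zs orbT].
Qed.

Lemma lspanZ Q : scalable_pred Q -> scalable_pred (lspan Q).
Proof.
move=> QZ a m [s [Qs ->]]; rewrite scaler_sumr.
elim: s Qs => [|y s IH] Qs; rewrite ?big_nil ?big_cons; first exact: lspan0.
apply: lspanD; first by apply/lspan_in/QZ/Qs/mem_head.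
by apply: IH => z zs; apply: Qs; rewrite inE zs orbT.
Qed.

Lemma lspan_subspace Q : scalable_pred Q -> subspace (lspan Q).
Proof. by move=> QZ; split=> [|a u v hu hv]; [exact: lspan0|apply: lspanD => //; apply: lspanZ]. Qed.

Lemma lspan_mono (Q Q' : U -> Prop) : (forall y, Q y -> Q' y) -> forall m, lspan Q m -> lspan Q' m.
Proof. by move=> QQ m [s [Qs ->]]; exists s; split=> // y /Qs /QQ. Qed.

End Span.

Lemma lin_0 (K : fieldType) (U V : lmodType K) (f : U -> V) : linear f -> f 0 = 0.
Proof. by move=> fl; have := fl (-1) 0 0; rewrite !scaleN1r oppr0 addr0 addNr. Qed.

Lemma lin_Z (K : fieldType) (U V : lmodType K) (f : U -> V) : linear f ->
  forall a u, f (a *: u) = a *: f u.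
Proof. by move=> fl a u; rewrite -[a *: u]addr0 fl (lin_0 fl) addr0. Qed.

Lemma lin_D (K : fieldType) (U V : lmodType K) (f : U -> V) : linear f ->
  forall u v, f (u + v) = f u + f v.
Proof. by move=> fl u v; rewrite -[u]scale1r fl !scale1r. Qed.

Lemma iter_linear (K : fieldType) (U : lmodType K) (g : U -> U) n : linear g -> linear (iter n g).
Proof. by move=> gl; elim: n => [|n IH] a u v //=; rewrite IH gl. Qed.

Section Sl2.
Variables (K : numFieldType) (U : lmodType K) (e f h : U -> U).
Hypotheses (el : linear e) (fl : linear f) (hl : linear h).
Hypothesis ef_h : forall m, e (f m) = f (e m) + h m.
Hypothesis he : forall m, h (e m) = e (h m) + 2 *: e m.
Hypothesis hf : forall m, h (f m) = f (h m) - 2 *: f m.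

Definition hpoly (ks : seq int) (m : U) : U :=
  foldr (fun k y => h y - k%:~R *: y) m ks.

Let eD := lin_D el. Let eZ := lin_Z el. Let e0 := lin_0 el.
Let fD := lin_D fl. Let fZ := lin_Z fl. Let f0 := lin_0 fl.
Let h0 := lin_0 hl.

Lemma e_iterf s m : e m = 0 ->
  e (iter s.+1 f m) = iter s f (s.+1%:R *: (h m - s%:R *: m)).
Proof.
move=> em0; have hs n : h (iter n f m) = iter n f (h m) - (n.*2)%:R *: iter n f m.
  elim: n => [|n IH]; first by rewrite scale0r subr0.
  rewrite iterS hf IH fD -scaleN1r fZ fZ scaleN1r -addrA -opprD -scalerDl.
  by rewrite -natrD doubleS addn2.
elim: s => [|s IH]; first by rewrite /= ef_h em0 f0 add0r scale0r subr0 scale1r.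
have fB n c : iter n f (h m - c *: m) = iter n f (h m) - c *: iter n f m.
  by rewrite addrC -scaleNr (iter_linear n fl) scaleNr addrC.
have fZn n c x : iter n f (c *: x) = c *: iter n f x by rewrite (lin_Z (iter_linear n fl)).
rewrite iterS ef_h IH -iterS !fZn !fB hs.
move: (iter _ _ _) (iter _ _ _) => x y.
rewrite -[X in _ + (X - _)]scale1r !scalerBr !scalerA addrACA -opprD -!scalerDl natr1.
by congr (_ - _ *: _); rewrite -mul2n natrM -!natr1; ring.
Qed.

(** The torus acts semisimply with integral eigenvalues: on vectors killed by e this
   is read off from the formula for e f ^ s, and the general case follows by
   induction on the nilpotency order of e. *)
Lemma hpoly_annihilates r m : iter r e m = 0 -> (forall m, exists s, iter s f m = 0) ->
  exists ks, hpoly ks m = 0.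
Proof.
move=> em fn; elim: r m em => [|r IH] m em; first by exists [::].
have hpe ks y : hpoly ks (e y) = e (hpoly [seq k - 2 | k <- ks] y).
  elim: ks => //= k ks ->; set z := hpoly _ y.
  have eB a c b : e (a - c *: b) = e a - c *: e b.
    by rewrite eD -!scaleNr eZ.
  by rewrite he eB rmorphB /= scalerBl opprB addrA addrAC.
have base s y : e y = 0 -> iter s f y = 0 -> exists ks, hpoly ks y = 0.
  elim: s y => [|s IHs] y ey sy; first by exists [::].
  have := e_iterf s ey; rewrite sy e0 (lin_Z (iter_linear s fl)) => /esym/eqP.
  rewrite scaler_eq0 pnatr_eq0 /= => /eqP hs.
  have [|ks ksP] := IHs (h y - s%:R *: y) _ hs.
    rewrite eD -!scaleNr eZ ey scaler0 addr0; apply: (addIr (2 *: e y)).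
    by rewrite -he ey h0 scaler0 addr0.
  by exists (rcons ks s%:Z); rewrite /hpoly foldr_rcons.
have [ks ksP] : exists ks, hpoly ks (e m) = 0 by apply: IH; rewrite -iterSr.
have [s sP] := fn (hpoly [seq k - 2 | k <- ks] m).
rewrite hpe in ksP; have [ks' ks'P] := base _ _ ksP sP.
by exists (ks' ++ [seq k - 2 | k <- ks]); rewrite /hpoly foldr_cat.
Qed.

(** Induction on the nilpotency order of f at m: by the formula for e ^ n f, the vector
    f m satisfies the hypotheses for k + 2, hence vanishes. For f m = 0, the same
    formula descends from e ^ k m = 0 to m = 0. *)
Lemma sl2_injective s k m : iter s f m = 0 -> h m = - k%:R *: m -> iter k e m = 0 -> m = 0.
Proof.
have fe n y c : h y = c *: y ->
  iter n.+1 e (f y) = f (iter n.+1 e y) + (n.+1%:R * (c + n%:R)) *: iter n e y.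
  move=> hy; have hs j : h (iter j e y) = (c + (j.*2)%:R) *: iter j e y.
    elim: j => [|j IH]; first by rewrite addr0.
    by rewrite iterS he IH eZ -scalerDl -addrA -natrD doubleS addn2.
  elim: n => [|n IH]; first by rewrite /= ef_h hy addr0 mul1r.
  rewrite iterS IH eD ef_h hs eZ -!iterS -addrA -scalerDl; congr (_ + _ *: _).
  by rewrite -mul2n natrM -!natr1; ring.
elim: s k m => [|s IH] k m // fs hm em.
have fm0 : f m = 0.
  apply: (IH k.+2); first by rewrite -iterSr.
    by rewrite hf hm fZ -scalerBl -!natr1; congr (_ *: _); ring.
  by rewrite (fe _ _ _ hm) !iterS em !(e0, f0, scaler0, add0r).
elim: k hm em => [|k IHk] hm em //.
suff desc j : (j <= k.+1)%N -> iter (k.+1 - j) e m = 0 by rewrite -(desc k.+1) ?subnn.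
elim: j => [|j IHj] jk; first by rewrite subn0.
have := fe (k - j)%N _ _ hm; rewrite fm0 (lin_0 (iter_linear _ el)).
rewrite -subSn // IHj ?(ltnW jk) // f0 add0r subSS => /esym/eqP.
rewrite scaler_eq0 => /orP[|/eqP //].
rewrite mulf_eq0 pnatr_eq0 subn_eq0 leqNgt jk /= natrB // -natr1 opprD => /eqP h0'; exfalso.
have /eqP : j.+1%:R = 0 :> K by rewrite -natr1 -[RHS]oppr0 -h0'; ring.
by rewrite pnatr_eq0.
Qed.

End Sl2.

(** * Weights and monomials *)

Section Action.
Variables (K : numClosedFieldType) (U : lmodType K) (E : bool -> idx -> idx -> U -> U).

(** The bracket relations of the basis elements, for operators on a plain vector space:
    in this form an action can be twisted by an automorphism. *)
Definition is_action : Prop :=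
  (forall p i j, linear (E p i j)) /\
  (forall p r i j k l m, E p i j (E r k l m) =
     sgn K (p && r) *: E r k l (E p i j m) +
     ((j == k)%:R *: E (p (+) r) i l m -
      (sgn K (p && r) * (i == l)%:R) *: E (p (+) r) k j m)).

Hypothesis HE : is_action.
Let El p i j : linear (E p i j) := HE.1 p i j.
Let Ebr := HE.2.
Let E0 p i j := lin_0 (El p i j).
Let EZ p i j := lin_Z (El p i j).

Definition weight := idx -> int.

Definition wt (nu : weight) (m : U) : Prop :=
  forall i, E false i i m = (nu i)%:~R *: m.

Definition shift (k : int) (i j : idx) (nu : weight) : weight :=
  fun l => nu l + k * ((l == i)%:Z - (l == j)%:Z).

Lemma wt_subspace nu : subspace (wt nu).
Proof.
split=> [i|a u v hu hv i]; first by rewrite E0 scaler0.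
by rewrite El hu hv scalerDr !scalerA mulrC.
Qed.

Lemma wt_eq nu nu' m : (forall i, nu i = nu' i) -> wt nu m -> wt nu' m.
Proof. by move=> nn hm i; rewrite hm nn. Qed.

Lemma wt_E p i j nu m : wt nu m -> wt (shift 1 i j nu) (E p i j m).
Proof.
move=> hm k; rewrite Ebr /= hm EZ scale1r mul1r /shift mul1r.
rewrite rmorphD rmorphB /= scalerDl scalerBl; congr (_ + (_ - _)).
  by case: eqP => [->|_] /=; rewrite ?scale1r ?scale0r.
by case: eqP => [->|_] /=; rewrite ?scale1r ?scale0r.
Qed.

Lemma wt_iterE i j nu m n : wt nu m -> wt (shift n%:Z i j nu) (iter n (E false i j) m).
Proof.
move=> hm; elim: n => [|n IH]; first by apply: wt_eq hm => l; rewrite /shift mul0r addr0.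
apply: wt_eq (wt_E false i j IH) => l; rewrite /shift -addrA -mulrDl; congr (_ + _ * _); lia.
Qed.

(** Applying h_i - mu_i, where mu is the weight of the first summand and differs
    from nu at i, multiplies the sum by a nonzero scalar and removes that summand. *)
Lemma wt_independent nu (s : seq U) : wt nu (\sum_(y <- s) y) ->
  (forall y, y \in s -> exists2 mu, wt mu y & exists i, mu i != nu i) ->
  \sum_(y <- s) y = 0.
Proof.
move sn: (size s) => n; elim: n s sn => [|n IH] [|y s] //= sn hz hs; rewrite ?big_nil //.
have [mu hy [i yi]] := hs y (mem_head _ _).
set z := \sum_(_ <- _) _ in hz *.
pose g x := E false i i x - (mu i)%:~R *: x.
have gl : linear g.
  move=> a u v; rewrite /g El !scalerDr opprD addrACA scalerN !scalerA.
  by rewrite [a * _]mulrC.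
have gz : g z = \sum_(x <- map g s) x.
  rewrite /z big_cons (lin_D gl) {1}/g hy subrr add0r big_map.
  exact: (big_morph g (lin_D gl) (lin_0 gl)).
have gzE : g z = (nu i - mu i)%:~R *: z by rewrite /g hz rmorphB scalerBl.
have : g z = 0.
  rewrite gz; apply: IH; first by rewrite size_map; case: sn.
    by rewrite -gz gzE; apply: (subspaceZ (wt_subspace nu)).
  move=> _ /mapP[x xs ->].
  have [mu' hx neq] : exists2 mu', wt mu' x & exists i, mu' i != nu i.
    by apply: hs; rewrite inE xs orbT.
  by exists mu' => //; rewrite /g hx -scalerBl; apply: (subspaceZ (wt_subspace mu')).
move/eqP; rewrite gzE scaler_eq0 intr_eq0 subr_eq0 => /orP[|/eqP //].
by rewrite eq_sym (negbTE yi).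
Qed.

Lemma wt_unique nu mu m : m != 0 -> wt nu m -> wt mu m -> forall i, nu i = mu i.
Proof.
move=> m0 hn hm i; have /eqP := hn i; rewrite hm -subr_eq0 -scalerBl scaler_eq0 (negbTE m0) orbF.
by rewrite subr_eq0 eqr_int => /eqP.
Qed.

Section Monomials.
Variables (G L : idx -> idx -> Prop) (Q : U -> Prop).

Inductive mon : nat -> U -> Prop :=
| mon0 y : Q y -> mon 0 y
| monS k p i j y : G i j -> mon k y -> mon k.+1 (E p i j y).

Hypothesis QZ : scalable_pred Q.

Lemma mon_scalable k : scalable_pred (mon k).
Proof.
move=> a y; elim=> [{}y Qy|{}k p i j {}y ij _ IH]; first by constructor; apply: QZ.
by rewrite -EZ; constructor.
Qed.

Hypothesis Ltrans : forall i j k, L i j -> L j k -> L i k.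
Hypothesis GL : forall i j, G i j -> L i j.
Hypothesis QL : forall p i j y, L i j -> ~ G i j -> Q y -> lspan Q (E p i j y).

(** The spanning part of the Poincare-Birkhoff-Witt theorem: if the elements of L
   outside G preserve the span of Q, then commuting them to the right shows that the
   monomials in G applied to Q span a subspace preserved by L. *)
Lemma mon_stable p i j m : L i j ->
  lspan (fun y => exists k, mon k y) m -> lspan (fun y => exists k, mon k y) (E p i j m).
Proof.
pose S k := lspan (fun y => exists2 n, (n <= k)%N & mon n y).
have Ssc k : scalable_pred (fun y => exists2 n, (n <= k)%N & mon n y).
  by move=> a y [n nk hy]; exists n => //; apply: mon_scalable.
have SS k : subspace (S k) by apply: lspan_subspace.
have Smono k n : (k <= n)%N -> forall y, S k y -> S n y.
  by move=> kn; apply: lspan_mono => y [x xk hy]; exists x => //; apply: leq_trans kn.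
have SG q a b k y : G a b -> S k y -> S k.+1 (E q a b y).
  move=> ab; move: y; apply: lspan_ind.
    by split=> [|c u v hu hv]; rewrite ?E0 ?El; [case: (SS k.+1)|apply: (SS k.+1).2].
  by move=> y [n nk hy]; apply: lspan_in; exists n.+1 => //; constructor.
have SL q a b k y : mon k y -> L a b -> ~ G a b -> S k (E q a b y).
  move=> hy; elim: hy q a b => [{}y Qy|{}k r c d {}y cd hy IH] q a b ab nG.
    by apply: lspan_mono (QL q ab nG Qy) => z Qz; exists 0%N => //; constructor.
  have SE t x z : L x z -> S k.+1 (E t x z y).
    move=> xz; have [xzG|xzG] := pselect (G x z).
      by apply: SG => //; apply: lspan_in; exists k.
    by apply: (Smono k) => //; apply: IH.
  rewrite Ebr; apply: subspaceD => //.
    by apply: subspaceZ => //; apply: SG => //; apply: IH.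
  apply: subspaceB => //.
    case: eqP => [bc|_]; last by rewrite scale0r; case: (SS k.+1).
    by apply: subspaceZ => //; apply: SE; apply: (Ltrans ab); rewrite bc; apply: GL.
  case: eqP => [ad|_]; last by rewrite mulr0 scale0r; case: (SS k.+1).
  by apply: subspaceZ => //; apply: SE; apply: Ltrans ab; rewrite ad; apply: GL.
move=> ij; move: m; apply: lspan_ind.
  have hs : subspace (lspan (fun y => exists k, mon k y)).
    by apply: lspan_subspace => a y [k hy]; exists k; apply: mon_scalable.
  by split=> [|c u v hu hv]; rewrite ?E0 ?El; [case: hs|apply: hs.2].
move=> y [k hy]; have [ijG|ijG] := pselect (G i j).
  by apply: lspan_in; exists k.+1; constructor.
by apply: lspan_mono (SL p _ _ _ _ hy ij ijG) => z [n _ hz]; exists n.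
Qed.

End Monomials.
End Action.

(** * Nilpotency of the radical of a parabolic subalgebra *)

Lemma fresh (s : seq idx) : exists j, j \notin s.
Proof.
pose m := (\max_(i <- s) `|val i|)%N.
exists (exist _ (m.+1%:Z) isT : idx); apply/negP => /(@leq_bigmax_seq _ s xpredT (fun i => `|val i|%N)).
by move=> /(_ isT); rewrite -/m /= ltnn.
Qed.

Section Nilpotency.
Variables (K : numClosedFieldType) (U : lmodType K) (E : bool -> idx -> idx -> U -> U).
Hypothesis HE : is_action E.
Let El p i j : linear (E p i j) := HE.1 p i j.
Let Ebr := HE.2.
Let E0 p i j := lin_0 (El p i j).
Let EZ p i j := lin_Z (El p i j).
Let ED p i j := lin_D (El p i j).

Definition locally_nilpotent (g : U -> U) : Prop := forall m, exists s, iter s g m = 0.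

Lemma sl2_relations i j (e := E false i j) (f := E false j i)
    (h := fun m => E false i i m - E false j j m) : i != j ->
  [/\ linear h, forall m, e (f m) = f (e m) + h m, forall m, h (e m) = e (h m) + 2 *: e m
    & forall m, h (f m) = f (h m) - 2 *: f m].
Proof.
move=> ij; have ji : j != i by rewrite eq_sym.
have EB p k l u v : E p k l (u - v) = E p k l u - E p k l v.
  by rewrite ED -scaleN1r EZ scaleN1r.
split=> [a u v|m|m|m]; rewrite /e /f /h.
- by rewrite !El scalerBr opprD addrACA.
- by rewrite Ebr /sgn /= !eqxx expr0 !scale1r mulr1 scale1r.
- rewrite !(Ebr false false _ _ i j) /sgn /= !eqxx (negbTE ij) (negbTE ji) expr0 !mul1r !scale1r !scale0r.
  by rewrite EB subr0 add0r opprD opprK addrACA -[2]/(1 + 1) scalerDl scale1r.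
- rewrite !(Ebr false false _ _ j i) /sgn /= !eqxx (negbTE ij) (negbTE ji) expr0 !mul1r !scale1r !scale0r.
  by rewrite EB subr0 sub0r opprD addrACA -opprD -[2]/(1 + 1) scalerDl scale1r.
Qed.

Lemma root_injective i j nu m (k : nat) : i != j -> locally_nilpotent (E false j i) ->
  wt E nu m -> nu j - nu i = k%:Z -> iter k (E false i j) m = 0 -> m = 0.
Proof.
move=> ij fn hm nk em; have [hl ef he hf] := sl2_relations ij.
have [s fs] := fn m; apply: (sl2_injective (El _ _ _) (El _ _ _) ef he hf fs _ em).
by rewrite !hm -scalerBl -rmorphB -opprB nk rmorphN.
Qed.

Lemma torus_polynomial i j m : i != j -> locally_nilpotent (E false i j) ->
  locally_nilpotent (E false j i) ->
  exists ks, hpoly (fun m => E false i i m - E false j j m) ks m = 0.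
Proof.
move=> ij en fn; have [hl ef he hf] := sl2_relations ij.
have [r er] := en m; exact: (hpoly_annihilates (El _ _ _) (El _ _ _) hl ef he hf er fn).
Qed.

(** Vanishing of all words of length k, by recursion on the first letter applied: stability
    under an operator then follows from its commutation with a single letter. *)
Fixpoint wnilp (Lam : idx -> idx -> Prop) (k : nat) (y : U) : Prop :=
  if k is k'.+1 then forall p i j, Lam i j -> wnilp Lam k' (E p i j y) else y = 0.

Lemma wnilp_subspace Lam k : subspace (wnilp Lam k).
Proof.
elim: k => [|k IH] /=; first by split=> // a u v -> ->; rewrite scaler0 addr0.
split=> [p i j ij|a u v hu hv p i j ij]; first by rewrite E0; case: IH.
by rewrite El; apply: IH.2; [apply: hu|apply: hv].
Qed.

Lemma wnilp_sub (Lam Lam' : idx -> idx -> Prop) k : (forall i j, Lam' i j -> Lam i j) ->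
  forall y, wnilp Lam k y -> wnilp Lam' k y.
Proof. by move=> sub; elim: k => //= k IH y hy p i j /sub ij; apply/IH/hy. Qed.

Lemma wnilp_iter (Lam : idx -> idx -> Prop) k n i j y : Lam i j -> wnilp Lam k y -> (k <= n)%N ->
  iter n (E false i j) y = 0.
Proof.
move=> ij hy /subnK <-; move: (n - k)%N => d; rewrite addnC; elim: k y hy => [|k IH] y hy.
  by rewrite add0n hy (lin_0 (iter_linear _ (El _ _ _))).
by rewrite addSn iterSr IH //; apply: hy.
Qed.

Lemma wnilp_comm (Lam : idx -> idx -> Prop) q a b k y :
  (forall p i j z, Lam i j -> E p i j (E q a b z) = sgn K (p && q) *: E q a b (E p i j z)) ->
  wnilp Lam k y -> wnilp Lam k (E q a b y).
Proof.
move=> comm; elim: k y => [|k IH] y /= hy; first by rewrite hy E0.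
move=> p i j ij; rewrite comm //; apply: (subspaceZ (wnilp_subspace _ _)).
by apply/IH/hy.
Qed.

Variable J : seq idx.

(** The radical of the parabolic subalgebra attached to J. *)
Definition cross (i j : idx) : Prop := i \in J /\ j \notin J.

Lemma neqJ i j : i \in J -> j \notin J -> (i == j) = false.
Proof. by move=> iJ; apply: contraNF => /eqP <-. Qed.

Lemma neqJ' i j : i \in J -> j \notin J -> (j == i) = false.
Proof. by rewrite eq_sym; exact: neqJ. Qed.

Lemma cross_comm p q i j a b z : cross i j -> cross a b ->
  E p i j (E q a b z) = sgn K (p && q) *: E q a b (E p i j z).
Proof.
move=> [iJ jJ] [aJ bJ]; rewrite Ebr neqJ' // neqJ // mulr0 !scale0r subr0.
by rewrite addr0.
Qed.

(** Letters of the radical supercommute, so a letter of one kind lowers one of the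
    two exponents and preserves the other property. *)
Lemma wnilp_union (L1 L2 : idx -> idx -> Prop) R r y :
  (forall i j, L1 i j -> cross i j) -> (forall i j, L2 i j -> cross i j) ->
  wnilp L1 R y -> wnilp L2 r y -> wnilp (fun i j => L1 i j \/ L2 i j) (R + r) y.
Proof.
move=> c1 c2; move Nn: (R + r)%N => n; elim: n R r y Nn => [|n IH] [|R] [|r] y //= Nn.
- by move=> -> _ p i j _; rewrite E0; case: (wnilp_subspace (fun i j => L1 i j \/ L2 i j) n).
- by move=> _ -> p i j _; rewrite E0; case: (wnilp_subspace (fun i j => L1 i j \/ L2 i j) n).
- move=> h1 h2 p i j [ij|ij].
    apply: (IH R r.+1); [by move: Nn; rewrite addSn => -[]|exact: h1|].
    by apply: (wnilp_comm (k := r.+1)) => // *; apply: cross_comm; auto.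
  apply: (IH R.+1 r); [by move: Nn; rewrite addnS => -[]| |exact: h2].
  by apply: (wnilp_comm (k := R.+1)) => // *; apply: cross_comm; auto.
Qed.

(** The Levi factor normalizes the radical. *)
Lemma wnilp_stable q a b k y : (a \in J) = (b \in J) -> wnilp cross k y -> wnilp cross k (E q a b y).
Proof.
move=> abJ; elim: k y => [|k IH] y /= hy; first by rewrite hy E0.
have hs := wnilp_subspace cross k.
move=> p i j ij; have [iJ jJ] := ij; rewrite Ebr; apply: subspaceD => //.
  by apply: subspaceZ => //; apply/IH/hy.
apply: subspaceB => //.
  case: eqP => [ja|_]; last by rewrite scale0r; case: hs.
  by apply: subspaceZ => //; apply: hy; split; rewrite // -abJ -ja.
case: eqP => [ib|_]; last by rewrite mulr0 scale0r; case: hs.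
by apply: subspaceZ => //; apply: hy; split; rewrite // abJ -ib.
Qed.

Section Polarization.
Variable f : U.
Hypothesis killed : forall p a b, a \notin J -> b \notin J -> E p a b f = 0.

(** Polarization: the elements E p j0 j with j outside J kill f and turn a factor
   E false i j0 into E p i j, so that the vanishing of
   one power E false i j0 ^ r on f spreads to all products of length r with column indices
   other than j0. *)
Lemma polarize i j0 r : i \in J -> j0 \notin J -> iter r (E false i j0) f = 0 ->
  wnilp (fun a b => [/\ a = i, b \notin J & b != j0]) r f.
Proof.
move=> iJ j0J fr; set Lam := fun _ _ => _.
suff H k : (k <= r)%N -> wnilp Lam k (iter (r - k) (E false i j0) f).
  by have := H r (leqnn _); rewrite subnn.
elim: k => [|k IH] kr; first by rewrite subn0.
have {IH} := IH (ltnW kr); rewrite -subSS subSn //; set t := (r - k.+1)%N => IH.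
move=> p _ b [-> bJ bj0].
have comm n : E p i b (iter n (E false i j0) f) = iter n (E false i j0) (E p i b f).
  elim: n => //= n <-; rewrite cross_comm // andbF /sgn expr0 scale1r //.
have Yx n : E p j0 b (iter n.+1 (E false i j0) f) = - n.+1%:R *: E p i b (iter n (E false i j0) f).
  elim: n => [|n IHn].
    rewrite /= Ebr killed // E0 scaler0 add0r andbF /sgn expr0 eqxx neqJ' // scale0r sub0r.
    by rewrite addbF mulr1 scaleN1r scale1r.
  rewrite iterS Ebr IHn EZ andbF /sgn expr0 eqxx neqJ' // scale0r sub0r !scale1r mulr1 addbF.
  by rewrite !comm -iterS -scalerBl -[in RHS]natr1 opprD.
have : wnilp Lam k (E p j0 b (iter t.+1 (E false i j0) f)).
  apply: wnilp_comm => // q _ c z [-> cJ cj0].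
  rewrite Ebr (negbTE cj0) neqJ // mulr0 !scale0r subr0 addr0 //.
rewrite Yx => /(subspaceZ (wnilp_subspace Lam k) (- t.+1%:R)^-1).
by rewrite scalerA mulVf ?scale1r // oppr_eq0 pnatr_eq0.
Qed.

(** A single j0 leaves out the words that contain it, so two of them are needed. *)
Lemma wnilp_row i : i \in J -> (forall j, j \notin J -> locally_nilpotent (E false i j)) ->
  exists r, wnilp (fun a b => a = i /\ b \notin J) r f.
Proof.
move=> iJ en; have [j0 j0J] := fresh J; have [j1] := fresh (j0 :: J).
rewrite inE negb_or => /andP[j10 j1J].
have [r0 h0] := en j0 j0J f; have [r1 h1] := en j1 j1J f.
exists (r0 + r1)%N.
apply: (wnilp_sub _ (wnilp_union _ _ (polarize iJ j0J h0) (polarize iJ j1J h1))).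
- move=> a b [-> bJ]; have [->|bj0] := eqVneq b j0; [right|left]; split => //.
  by rewrite eq_sym.
- by move=> a b [-> ? _].
- by move=> a b [-> ? _].
Qed.

Lemma wnilp_cross : (forall i j, i != j -> locally_nilpotent (E false i j)) ->
  exists R, wnilp cross R f.
Proof.
move=> en; suff H (s : seq idx) : {subset s <= J} -> exists R, wnilp (fun a b => a \in s /\ b \notin J) R f.
  by have [R hR] := H J (fun _ => id); exists R.
elim: s => [|i s IH] sJ; first by exists 1%N => p a b [].
have [R hR] : exists R, wnilp (fun a b => a \in s /\ b \notin J) R f.
  by apply: IH => x xs; apply: sJ; rewrite inE xs orbT.
have iJ : i \in J by apply: sJ; rewrite mem_head.
have [r hr] : exists r, wnilp (fun a b => a = i /\ b \notin J) r f.
  by apply: wnilp_row => // j jJ; apply: en; rewrite neqJ.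
exists (r + R)%N; apply: (wnilp_sub _ (wnilp_union _ _ hr hR)).
- by move=> a b []; rewrite inE => /orP[/eqP ->|]; [left|right].
- by move=> a b [->].
- by move=> a b [ain ?]; split=> //; apply: sJ; rewrite inE ain orbT.
Qed.
End Polarization.
End Nilpotency.

(** * Boundedness of the weights in one direction *)

Definition mass_le (nu : weight) (B : nat) : Prop :=
  forall S : seq idx, uniq S -> (\sum_(i <- S) `|nu i|%N <= B)%N.

Lemma sum_pred1 (S : seq idx) i : uniq S -> (\sum_(l <- S) (l == i) = (i \in S))%N.
Proof.
move=> uS; rewrite -(count_uniq_mem i uS); elim: S {uS} => [|x S IH]; first by rewrite big_nil.
by rewrite big_cons IH.
Qed.

Lemma mass_shift nu B i j : mass_le nu B -> mass_le (shift 1 i j nu) (B + 2).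
Proof.
move=> hB S uS; apply: (@leq_trans (\sum_(l <- S) (`|nu l|%N + ((l == i) + (l == j))))%N).
  apply: leq_sum => l _; rewrite /shift; case: (l == i); case: (l == j) => /=; lia.
rewrite big_split /=; apply: leq_add; first exact: hB.
by rewrite big_split /= !sum_pred1 //; case: (_ \in _); case: (_ \in _).
Qed.

Lemma mass_eq nu nu' B : (forall i, nu i = nu' i) -> mass_le nu B -> mass_le nu' B.
Proof. by move=> nn hB S /hB; under eq_bigr do rewrite nn. Qed.

Section Bound.
Variables (K : numClosedFieldType) (U : lmodType K) (E : bool -> idx -> idx -> U -> U).
Hypothesis HE : is_action E.
Let El p i j : linear (E p i j) := HE.1 p i j.
Let Ebr := HE.2.
Let E0 p i j := lin_0 (El p i j).
Let EZ p i j := lin_Z (El p i j).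

Definition generates (f : U) : Prop := forall N : U -> Prop, subspace N ->
  (forall p i j m, N m -> N (E p i j m)) -> N f -> forall m, N m.

Hypothesis nilE : forall i j, i != j -> locally_nilpotent (E false i j).
Variables (J : seq idx) (f : U) (nu0 : weight).
Hypothesis uJ : uniq J.
Hypothesis fgen : generates f.
Hypothesis fwt : wt E nu0 f.
Hypothesis killed : forall p a b, a \notin J -> b \notin J -> E p a b f = 0.

(** The degree of a weight for the parabolic subalgebra attached to J. *)
Definition Jdeg (nu : weight) : int := \sum_(i <- J) nu i.

Lemma Jdeg_shift nu i j : Jdeg (shift 1 i j nu) = Jdeg nu + ((i \in J)%:Z - (j \in J)%:Z).
Proof.
rewrite /Jdeg /shift big_split /=; congr (_ + _).
under eq_bigr do rewrite mul1r; rewrite sumrB -!sum_pred1 //.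
by rewrite !(big_morph Posz PoszD (erefl _)).
Qed.

Lemma Jdeg_eq nu nu' : (forall i, nu i = nu' i) -> Jdeg nu = Jdeg nu'.
Proof. by move=> nn; apply: eq_bigr => i _; rewrite nn. Qed.

(** These properties of f are inherited by the module that it generates over the Levi
    factor of J. *)
Definition levi_vec (R : nat) (y : U) : Prop :=
  [/\ exists2 nu, wt E nu y & Jdeg nu = Jdeg nu0,
      forall p a b, a \notin J -> b \notin J -> E p a b y = 0 & wnilp E (cross J) R y].

Lemma levi_scalable R : scalable_pred (levi_vec R).
Proof.
move=> a y [[nu hy dn] ky ny]; split=> [|p b c bJ cJ|].
- by exists nu => //; apply: (subspaceZ (wt_subspace HE nu)).
- by rewrite EZ ky // scaler0.
- exact: (subspaceZ (wnilp_subspace HE _ _)).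
Qed.

Lemma levi_E R p i j y : i \in J -> j \in J -> levi_vec R y -> levi_vec R (E p i j y).
Proof.
move=> iJ jJ [[nu hy dn] ky ny]; split=> [|q b c bJ cJ|].
- by exists (shift 1 i j nu); [exact: wt_E|rewrite Jdeg_shift iJ jJ subrr addr0].
- by rewrite Ebr ky // E0 scaler0 add0r (neqJ' iJ cJ) (neqJ' jJ bJ) mulr0 !scale0r subr0.
- by apply: wnilp_stable; rewrite ?iJ ?jJ.
Qed.

(** The weight vanishes outside J. At i in J it is at least -R, since sl(2) would
    otherwise provide a nonzero product of R elements of the radical; the sum over J
    being fixed, it is also bounded above. *)
Lemma levi_mass R y nu : levi_vec R y -> y != 0 -> wt E nu y ->
  mass_le nu (size J * (`|Jdeg nu0| + size J * R)).
Proof.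
move=> [[nu' hy' dn] ky ny] y0 hy; have nn := wt_unique y0 hy' hy.
rewrite (Jdeg_eq nn) in dn.
have out j : j \notin J -> nu j = 0.
  move=> jJ; have /esym/eqP := hy j; rewrite ky // scaler_eq0 (negbTE y0) orbF intr_eq0.
  by move/eqP.
have low i : i \in J -> - R%:Z <= nu i.
  move=> iJ; rewrite leNgt; apply/negP => lt; have [j jJ] := fresh J.
  have ij : i != j by rewrite (neqJ iJ jJ).
  move/eqP: y0; apply; apply: (@root_injective _ _ _ HE i j nu y `|nu i| ij) => //.
    by apply: nilE; rewrite eq_sym.
    by rewrite (out j) //; lia.
  by apply: (wnilp_iter HE (Lam := cross J) _ ny) => //; lia.
have lows s : {subset s <= J} -> - (size s * R)%:Z <= \sum_(i <- s) nu i.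
  elim: s => [|i s IH] sJ; first by rewrite big_nil.
  rewrite big_cons; have := low i (sJ i (mem_head _ _)).
  have : - (size s * R)%:Z <= \sum_(i <- s) nu i.
    by apply: IH => x xs; apply: sJ; rewrite inE xs orbT.
  rewrite /= mulSn; lia.
have absle i : i \in J -> (`|nu i| <= `|Jdeg nu0| + size J * R)%N.
  move=> iJ; have := dn; rewrite /Jdeg (bigD1_seq i) //= -big_filter.
  have := lows (rem i J) (fun x => @mem_rem _ i J x).
  have -> : [seq x <- J | x != i] = rem i J by rewrite rem_filter.
  rewrite -/(Jdeg nu0) size_rem //; move: (\sum_(_ <- _) _) (low i iJ) => x.
  have: (0 < size J)%N by case: (J) iJ.
  case: (size J) => // n _ /=; rewrite mulSn; lia.
move=> S uS.
have -> : (\sum_(i <- S) `|nu i|%N = \sum_(i <- [seq i <- S | i \in J]) `|nu i|%N)%N.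
  rewrite big_filter [LHS](bigID (mem J)) /= [X in (_ + X)%N]big1 ?addn0 // => j jJ.
  by rewrite out.
apply: (@leq_trans (\sum_(i <- [seq i <- S | i \in J]) (`|Jdeg nu0| + size J * R))%N).
  rewrite !big_filter; apply: leq_sum => i; exact: absle.
rewrite big_const_seq count_predT iter_addn_0 mulnC leq_mul2r; apply/orP; right.
apply: uniq_leq_size; first exact: filter_uniq.
by move=> i; rewrite mem_filter => /andP[].
Qed.

(** M is spanned by products of a elements of the opposite radical, applied to
    products of k elements of the radical, applied to vectors for the Levi factor; k
    is at most R, and the weight of such a product is read off from k and a. *)
Lemma gen_bound : exists R0 B0 : nat, forall nu y, y != 0 -> wt E nu y ->
  exists k a : nat, [/\ (k <= R0)%N, Jdeg nu = Jdeg nu0 + k%:Z - a%:Z &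
    mass_le nu (B0 + (k + a) * 2)].
Proof.
have [R hR] := wnilp_cross HE killed nilE.
pose B0 := (size J * (`|Jdeg nu0| + size J * R))%N.
exists R, B0.
pose Q1 y := exists k, mon E (cross J) (levi_vec R) k y.
pose L1 i j := i \in J \/ j \notin J.
have Q1Z : scalable_pred Q1.
  by move=> a y [k hy]; exists k; apply: (mon_scalable HE (@levi_scalable R)).
have st1 p i j m : L1 i j -> lspan Q1 m -> lspan Q1 (E p i j m).
  apply: (mon_stable HE (L := L1)).
  - exact: levi_scalable.
  - by move=> i' j' k' [hi|hj] [hj'|hk]; rewrite /L1; try by [left|right]; rewrite hj' in hj.
  - by move=> i' j' [? ?]; left.
  - move=> q i' j' y ij nij hy; have [iJ|iJ] := boolP (i' \in J).
      have [jJ|jJ] := boolP (j' \in J); last by case: nij.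
      by apply: lspan_in; apply: levi_E.
    case: ij; rewrite ?(negbTE iJ) // => jJ; have [_ ky _] := hy.
    by rewrite ky //; exact: lspan0.
pose G2 i j := j \in J /\ i \notin J.
pose Q2 y := exists a, mon E G2 Q1 a y.
have st2 p i j m : lspan Q2 m -> lspan Q2 (E p i j m).
  apply: (mon_stable HE (L := fun _ _ => True)) => // q i' j' y _ nij hy.
  apply: st1; last exact: lspan_in.
  rewrite /L1; have [iJ|iJ] := boolP (i' \in J); first by left.
  by right; apply/negP => jJ; case: nij.
have Q2Z : scalable_pred Q2.
  by move=> a y [k hy]; exists k; apply: (mon_scalable HE Q1Z).
have all m : lspan Q2 m.
  apply: (fgen (lspan_subspace Q2Z)); first by move=> *; apply: st2.
  apply: lspan_in; exists 0%N; constructor; exists 0%N; constructor.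
  by split=> //; exists nu0.
have wt1 k y : mon E (cross J) (levi_vec R) k y -> wnilp E (cross J) (R - k) y /\
  (y != 0 -> exists nu, [/\ wt E nu y, Jdeg nu = Jdeg nu0 + k%:Z & mass_le nu (B0 + k * 2)]).
  elim=> [{}y hy|{}k p i j {}y [iJ jJ] _ [ny IH]].
    split=> [|y0]; first by rewrite subn0; case: hy.
    have [[nu wy dn] _ _] := hy; exists nu; rewrite addr0 addn0; split => //.
    exact: levi_mass wy.
  split.
    rewrite subnS; case: (R - k)%N ny => [|t] /= ny; first by rewrite ny E0.
    exact: ny.
  have [->|y0 _] := eqVneq y 0; first by rewrite E0 eqxx.
  have [nu [wy dn mn]] := IH y0; exists (shift 1 i j nu); split; first exact: wt_E.
    by rewrite Jdeg_shift iJ (negbTE jJ) dn -addrA; congr (_ + _); lia.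
  by have := mass_shift i j mn; congr mass_le; lia.
have wt2 a y : mon E G2 Q1 a y -> y != 0 -> exists nu k,
   [/\ wt E nu y, (k <= R)%N, Jdeg nu = Jdeg nu0 + k%:Z - a%:Z & mass_le nu (B0 + (k + a) * 2)].
  elim=> [{}y [k hy] y0|{}a p i j {}y [jJ iJ] _ IH].
    have [ny] := wt1 _ _ hy; move=> /(_ y0) [nu [wy dn mn]]; exists nu, k; split=> //.
    - rewrite leqNgt; apply/negP => Rk; move: ny; have -> : (R - k = 0)%N by lia.
      by move/eqP: y0.
    - by rewrite subr0.
    - by rewrite addn0.
  have [->|y0 _] := eqVneq y 0; first by rewrite E0 eqxx.
  have [nu [k [wy kR dn mn]]] := IH y0; exists (shift 1 i j nu), k.
  split=> //; first exact: wt_E.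
    by rewrite Jdeg_shift jJ (negbTE iJ) dn; lia.
  by have := mass_shift i j mn; congr mass_le; lia.
move=> nu y y0 wy; have [s [hs yE]] := all y.
have [[z zs [mu [wz [mun z0]]]]|none] := pselect (exists2 z, z \in s &
    exists mu, wt E mu z /\ ((forall i, mu i = nu i) /\ z != 0)).
  have [a hz] := hs z zs; have [nu' [k [wz' kR dn mn]]] := wt2 _ _ hz z0.
  have nn i : nu' i = nu i by rewrite -mun; apply: wt_unique wz' wz i.
  by exists k, a; rewrite -(Jdeg_eq nn); split=> //; apply: mass_eq mn.
exfalso; move/eqP: y0; apply; rewrite yE.
apply: (wt_independent HE (nu := nu)); first by rewrite -yE.
move=> z zs; have [->|z0] := eqVneq z 0.
  exists (fun i => nu i + 1); last by have [j _] := fresh [::]; exists j; lia.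
  by have [] := wt_subspace HE (fun i => nu i + 1).
have [a hz] := hs z zs; have [mu [k [wz _ _ _]]] := wt2 _ _ hz z0.
exists mu => //; apply: contrapT => h; apply: none; exists z => //; exists mu; split=> //.
by split=> // i; apply: contrapT => hi; apply: h; exists i; apply/eqP.
Qed.

End Bound.

(** * Boundedness of the weights and the maximal weight *)

Section DualAction.
Variables (K : numClosedFieldType) (U : lmodType K) (E : bool -> idx -> idx -> U -> U).

(** The Chevalley involution: the square root of -1 makes the transposition, with a
   sign, an automorphism of the superalgebra and exchanges the two parabolic
   subalgebras attached to J. *)
Definition chevalley (p : bool) (i j : idx) (m : U) : U := - ('i ^+ p) *: E p j i m.

Lemma chevalley_action : is_action E -> is_action chevalley.
Proof.
move=> [El Ebr]; split=> [p i j a u v|p r i j k l m].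
  by rewrite /chevalley El scalerDr !scalerA mulrC.
rewrite /chevalley (lin_Z (El _ _ _)) Ebr (lin_Z (El _ _ _)) !scalerDr !scalerN !scalerA.
have cM : - 'i ^+ p * - 'i ^+ r = - sgn K (p && r) * - 'i ^+ (p (+) r) :> K.
  by rewrite /sgn; case: p; case: r; rewrite /= ?expr0 ?expr1; try ring; rewrite -expr2 sqrrN sqrCi; ring.
have ss : sgn K (p && r) * sgn K (p && r) = 1 by rewrite /sgn -expr2 sqrr_sign.
rewrite -!scaleNr; congr (_ *: _ + _); first by ring.
rewrite [RHS]addrC; congr (_ *: _ + _ *: _); first by rewrite cM; ring.
transitivity (- (- 'i ^+ p * - 'i ^+ r) * sgn K (p && r) * (j == k)%:R : K); first by ring.
rewrite cM; transitivity (sgn K (p && r) * sgn K (p && r) * - 'i ^+ (p (+) r) * (j == k)%:R : K).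
  by ring.
by rewrite ss mul1r mulrC.
Qed.

Lemma chevalley_wt nu m : wt E nu m -> wt chevalley (fun i => - nu i) m.
Proof. by move=> hm i; rewrite /chevalley expr0 hm scaleN1r rmorphN scaleNr. Qed.

Lemma chevalley_neq0 p : - 'i ^+ p != 0 :> K.
Proof. by rewrite oppr_eq0 expf_eq0 negb_and neq0Ci orbT. Qed.

Lemma chevalley_iter i j n m : linear (E false j i) ->
  iter n (E false j i) m = 0 -> iter n (chevalley false i j) m = 0.
Proof.
move=> El; have -> : iter n (chevalley false i j) m = (-1) ^+ n *: iter n (E false j i) m.
  elim: n => [|n IH]; first by rewrite scale1r.
  by rewrite !iterS IH /chevalley expr0 (lin_Z El) scalerA exprS.
by move=> ->; rewrite scaler0.
Qed.

(** Applied to the module twisted by the Chevalley involution, gen_bound bounds the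
    degree in J from below; since this degree decreases with a, the exponent a is bounded. *)
Theorem weights_bounded (J : seq idx) (f : U) (nu0 : weight) : is_action E ->
  (forall i j, i != j -> locally_nilpotent (E false i j)) ->
  uniq J -> generates E f -> wt E nu0 f ->
  (forall p a b, a \notin J -> b \notin J -> E p a b f = 0) ->
  exists B, forall nu y, y != 0 -> wt E nu y -> mass_le nu B.
Proof.
move=> HE nilE uJ fgen fwt killed.
have [R [B0 H1]] := gen_bound HE nilE uJ fgen fwt killed.
have HE' := chevalley_action HE.
have [R' [B0' H2]] : exists R0 B0 : nat, forall nu y, y != 0 -> wt chevalley nu y ->
   exists k a : nat, [/\ (k <= R0)%N, Jdeg J nu = Jdeg J (fun i => - nu0 i) + k%:Z - a%:Z &
    mass_le nu (B0 + (k + a) * 2)].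
  apply: (@gen_bound _ _ _ HE' _ J f) => //.
  - move=> i j ij m; have [s hs] := nilE j i (introN eqP (fun e => elimN eqP ij (esym e))) m.
    by exists s; apply: chevalley_iter hs; exact: HE.1.
  - move=> N hN NE; apply: fgen => // p i j m /(NE p j i).
    move=> /(subspaceZ hN (- 'i ^+ p)^-1); rewrite /chevalley scalerA.
    by rewrite mulVf ?chevalley_neq0 // scale1r.
  - exact: chevalley_wt.
  - by move=> p a b aJ bJ; rewrite /chevalley killed // scaler0.
exists (B0 + (R + (R + R')) * 2)%N => nu y y0 hy S uS.
have [k [a [kR dn mn]]] := H1 nu y y0 hy.
have [k' [a' [kR' dn' _]]] := H2 _ y y0 (chevalley_wt hy).
rewrite /Jdeg !sumrN -!/(Jdeg _ _) in dn'.
have := mn S uS; lia.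
Qed.
End DualAction.

Lemma max_nat (P : nat -> Prop) B : (exists n, P n) -> (forall n, P n -> (n <= B)%N) ->
  exists2 n, P n & forall m, P m -> (m <= n)%N.
Proof.
move=> [n0 h0] hB; have ex : exists n, `[< P n >] by exists n0; apply/asboolP.
have bd n : `[< P n >] -> (n <= B)%N by move=> /asboolP; exact: hB.
case: (ex_maxnP ex bd) => n /asboolP hn hmax; exists n => // m hm.
by apply: hmax; apply/asboolP.
Qed.

Lemma max_int (P : int -> Prop) (B : int) : (exists n, P n) -> (forall n, P n -> n <= B) ->
  exists2 n, P n & forall m, P m -> m <= n.
Proof.
move=> [n0 h0] hB; pose Q n := P (n0 + Posz n).
have [|n /hB ?|n hn nmax] := @max_nat Q `|B - n0|%N; first by exists 0%N; rewrite /Q addr0.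
  by lia.
exists (n0 + Posz n) => // m hm; have [mn|nm] := leP m n0; first by lia.
have := nmax `|m - n0|%N; rewrite /Q; have -> : n0 + Posz `|m - n0|%N = m by lia.
by move=> /(_ hm); lia.
Qed.

Lemma precE (i j : idx) : prec i j = if (0 < val i) == (0 < val j) then val i < val j else 0 < val i.
Proof. by []. Qed.

Lemma prec_neq i j : prec i j -> i != j.
Proof. by apply: contraTneq => ->; rewrite /prec eqxx ltxx. Qed.

Section MaximalWeight.
Variables (K : numClosedFieldType) (U : lmodType K) (E : bool -> idx -> idx -> U -> U).
Hypothesis HE : is_action E.
Hypothesis nilE : forall i j, i != j -> locally_nilpotent (E false i j).

Definition is_weight (nu : weight) : Prop := exists2 y, y != 0 & wt E nu y.

(** Invariance under the reflection exchanging i and j. *)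
Lemma weight_swap nu i j : is_weight nu -> i != j -> nu i <= nu j ->
  is_weight (shift (nu j - nu i) i j nu).
Proof.
move=> [y y0 hy] ij le; have kE : nu j - nu i = `|nu j - nu i|%N by lia.
exists (iter `|nu j - nu i| (E false i j) y); last by rewrite {1}kE; apply: wt_iterE.
apply/eqP => h; move/eqP: y0; apply.
by apply: (root_injective HE ij _ hy kE h); apply: nilE; rewrite eq_sym.
Qed.

Definition mass (S : seq idx) (nu : weight) : nat := (\sum_(i <- S) `|nu i|)%N.

Lemma mass_pair S nu i j k : uniq S -> i \in S -> j \in S -> i != j ->
  (mass S (shift k i j nu) + (`|nu i| + `|nu j|) = mass S nu + (`|(nu i + k)%R| + `|(nu j - k)%R|))%N.
Proof.
move=> uS iS jS ij; rewrite /mass !(bigD1_seq i iS uS) /=.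
rewrite [X in (_ + X + _ = _)%N](bigID (pred1 j)) [X in (_ = _ + X + _)%N](bigID (pred1 j)) /=.
have sj (F : idx -> nat) : (\sum_(l <- S | (l != i) && (l == j)) F l = F j)%N.
  rewrite (eq_bigl (pred1 j)); last by move=> l /=; rewrite andbC; case: eqP => //= ->; rewrite eq_sym.
  by rewrite -big_filter filter_pred1_uniq // big_seq1.
rewrite !sj; have -> : (\sum_(l <- S | (l != i) && (l != j)) `|shift k i j nu l| =
  \sum_(l <- S | (l != i) && (l != j)) `|nu l|)%N.
  apply: eq_bigr => l /andP[/negbTE li /negbTE lj]; by rewrite /shift li lj subrr mulr0 addr0.
have -> : shift k i j nu i = nu i + k by rewrite /shift eqxx (negbTE ij) subr0 mulr1.
have -> : shift k i j nu j = nu j - k.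
  by rewrite /shift eqxx eq_sym (negbTE ij) sub0r mulrN1.
have e a b c d r : (a + (b + r) + (c + d) = c + (d + r) + (a + b))%N by lia.
exact: e.
Qed.

(** The coefficients p, ..., 1, 0, 0, ..., 0, -1, ..., -p along the order of the
    indices: weakly decreasing, and strictly so outside the zeros. *)
Definition slope (p : nat) (i : idx) : int :=
  if 0 < val i then Num.max 0 (p%:Z + 1 - val i) else Num.min 0 (- (p%:Z + 1 + val i)).

Definition window (p : nat) : seq idx := [seq I_enum k | k <- enum 'I_(p.*2)].

Lemma window_uniq p : uniq (window p).
Proof. by rewrite map_inj_uniq ?enum_uniq //; exact: I_enum_inj. Qed.

Lemma mem_window p i : (i \in window p) = in_I p.*2 i.
Proof.
apply/mapP/(I_enumP p.*2) => [[k _ ->]|[k ->]]; first by exists k.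
by exists k; rewrite ?mem_enum.
Qed.

Definition height (p : nat) (nu : weight) : int := \sum_(i <- window p) nu i * slope p i.

Lemma slope_out p i : i \notin window p -> slope p i = 0.
Proof.
case: i => i i0; rewrite mem_window /in_I /slope uphalf_double doubleK /=.
by case: (ltP 0 i) => ?; lia.
Qed.

Lemma height_shift p nu i j k :
  height p (shift k i j nu) = height p nu + k * (slope p i - slope p j).
Proof.
have delta i' : \sum_(l <- window p) (l == i')%:Z * slope p l = slope p i'.
  have [iw|/slope_out iw] := boolP (i' \in window p).
    rewrite (bigD1_seq i') ?window_uniq //= eqxx mul1r big1 ?addr0 // => l /negbTE ->.
    by rewrite mul0r.
  rewrite iw big1 // => l _; case: eqP => [->|_]; rewrite ?iw ?mulr0 ?mul0r //.
rewrite /height /shift; under eq_bigr do rewrite mulrDl -mulrA mulrBl.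
rewrite big_split /= -mulr_sumr sumrB; congr (_ + _ * (_ - _)); exact: delta.
Qed.

Lemma height_le p nu : (mass (window p) nu <= p)%N -> height p nu <= (p * p)%:Z.
Proof.
move=> hm; apply: (@le_trans _ _ ((mass (window p) nu * p)%N%:Z)); last by rewrite lez_nat leq_mul2r hm orbT.
rewrite /mass /height big_distrl /= (big_morph Posz PoszD (erefl _)).
apply: ler_sum => i _; rewrite PoszM.
have hs : `|slope p i| <= p%:Z.
  by rewrite /slope; case: i => i /= i0; case: (ltP 0 i) => ?; lia.
rewrite abszE; apply: (le_trans (ler_norm _)); rewrite normrM; apply: ler_pM => //.
Qed.

(** The weight nu maximizes the mass, and then the height. Exchanging two coordinates
    preserves the mass, so nu is sorted wherever the slopes differ; a
    positive coordinate at an index of slope <= 0 would make the first p coordinates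
    positive as well, contradicting the mass, and likewise for a negative one. Adding the
    positive root of i and j increases the mass if nu i >= 0 >= nu j, and else
    increases the height without changing the mass. *)
Theorem maximal_weight B nu0 : is_weight nu0 ->
  (forall nu, is_weight nu -> mass_le nu B) ->
  exists nu, [/\ is_weight nu, exists p : nat, forall i : idx, p%:Z < `|val i| -> nu i = 0,
    forall i j, prec i j -> nu j <= nu i,
    forall i : idx, if 0 < val i then 0 <= nu i else nu i <= 0
    & forall q i j y, prec i j -> wt E nu y -> E q i j y = 0].
Proof.
move=> h0 hB.
have [p [nu1 [S1 [h1 uS1 m1]]] pmax] : exists2 p, exists nu S, [/\ is_weight nu, uniq S & mass S nu = p] &
    forall m, (exists nu S, [/\ is_weight nu, uniq S & mass S nu = m]) -> (m <= p)%N.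
  apply: (@max_nat _ B); first by exists (mass [::] nu0), nu0, [::].
  by move=> n [nu [S [hnu uS <-]]]; exact: hB.
have {}pmax nu S : is_weight nu -> uniq S -> (mass S nu <= p)%N.
  by move=> hnu uS; apply: pmax; exists nu, S.
pose top nu := is_weight nu /\ exists2 S, uniq S & mass S nu = p.
have top_pair nu i j : top nu -> i != j -> exists S, [/\ uniq S, i \in S, j \in S & mass S nu = p].
  move=> [hnu [S uS mS]] ij; exists (undup (i :: j :: S)).
  rewrite undup_uniq !mem_undup !inE !eqxx !orbT; split=> //.
  apply/eqP; rewrite eqn_leq pmax ?undup_uniq // andTb -mS /mass.
  apply: (@uniq_sub_le_big _ addn leq leqnn (fun a b => leq_addr b a)) => //; rewrite ?undup_uniq //.
  by move=> l lS; rewrite mem_undup !inE lS !orbT.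
have top_shift nu i j k : top nu -> i != j -> is_weight (shift k i j nu) ->
    `|(nu i + k)%R|%N + `|(nu j - k)%R|%N = `|nu i|%N + `|nu j|%N -> top (shift k i j nu).
  move=> tnu ij hs e; have [S [uS iS jS mS]] := top_pair _ _ _ tnu ij.
  split=> //; exists S => //; have := mass_pair nu k uS iS jS ij; rewrite mS; lia.
have top_nogrow nu i j k : top nu -> i != j -> is_weight (shift k i j nu) ->
    (`|(nu i + k)%R|%N + `|(nu j - k)%R|%N <= `|nu i|%N + `|nu j|%N)%N.
  move=> tnu ij hs; have [S [uS iS jS mS]] := top_pair _ _ _ tnu ij.
  have := mass_pair nu k uS iS jS ij; have := pmax _ _ hs uS; rewrite mS; lia.
have [h [nu [tnu hE]] hmax] : exists2 h, exists nu, top nu /\ height p nu = h &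
    forall m, (exists nu, top nu /\ height p nu = m) -> m <= h.
  apply: (@max_int _ (p * p)%:Z); first by exists (height p nu1), nu1; split=> //; split=> //; exists S1.
  move=> _ [nu [[hnu _] <-]]; apply: height_le; apply: pmax => //; exact: window_uniq.
have {}hmax nu' : top nu' -> height p nu' <= height p nu by move=> ?; rewrite hE; apply: hmax; exists nu'.
have hnu : is_weight nu by case: tnu.
have swap i j : i != j -> slope p j < slope p i -> nu j <= nu i.
  move=> ij sij; rewrite leNgt; apply/negP => lt.
  have tw : top (shift (nu j - nu i) i j nu).
    by apply: top_shift => //; [apply: weight_swap => //; apply: ltW|lia].
  have := hmax _ tw; rewrite height_shift; nia.
have massle s : uniq s -> (mass s nu <= p)%N by exact: pmax.
(* If nu i > 0 at an index of slope at most 0, then swap makes nu positive at the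
   p indices of positive slope as well, and the mass exceeds p. *)
have over s : uniq s -> size s = p.+1 -> (forall l, l \in s -> nu l != 0) -> False.
  move=> us ss hs; have := massle s us; apply/negP; rewrite -ltnNge -ss -sum1_size /mass.
  by rewrite big_seq [X in (_ <= X)%N]big_seq; apply: leq_sum => l /hs; lia.
have neqz k : k.+1%:Z != 0 by [].
have neqn k : - k.+1%:Z != 0 by rewrite oppr_eq0.
have pos i : slope p i <= 0 -> nu i <= 0.
  move=> si; rewrite leNgt; apply/negP => ni.
  pose s := [seq (exist _ k.+1%:Z (neqz k) : idx) | k <- iota 0 p].
  have sl l : l \in s -> 0 < slope p l.
    by case/mapP => k; rewrite mem_iota => kp ->; rewrite /slope /=; lia.
  apply: (over (i :: s)).
  - rewrite /= map_inj_uniq ?iota_uniq ?andbT; last by move=> k l [].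
    by apply/negP => /sl; rewrite ltNge si.
  - by rewrite /= size_map size_iota.
  - move=> l; rewrite inE => /orP[/eqP ->|ls]; first by rewrite gt_eqF.
    have sil : slope p i < slope p l by apply: le_lt_trans si (sl _ ls).
    rewrite gt_eqF //; apply: lt_le_trans ni _; apply: swap => //.
    by apply: contraTneq sil => ->; rewrite ltxx.
have neg i : 0 <= slope p i -> 0 <= nu i.
  move=> si; rewrite leNgt; apply/negP => ni.
  pose s := [seq (exist _ (- k.+1%:Z) (neqn k) : idx) | k <- iota 0 p].
  have sl l : l \in s -> slope p l < 0.
    by case/mapP => k; rewrite mem_iota => kp ->; rewrite /slope /=; lia.
  apply: (over (i :: s)).
  - rewrite /= map_inj_uniq ?iota_uniq ?andbT; last by move=> k l [].
    by apply/negP => /sl; rewrite ltNge si.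
  - by rewrite /= size_map size_iota.
  - move=> l; rewrite inE => /orP[/eqP ->|ls]; first by rewrite lt_eqF.
    have sil : slope p l < slope p i by apply: lt_le_trans (sl _ ls) si.
    rewrite lt_eqF //; apply: le_lt_trans ni; apply: swap => //.
    by apply: contraTneq sil => ->; rewrite ltxx.
have slopeE i : slope p i = if 0 < val i then Num.max 0 (p%:Z + 1 - val i) else Num.min 0 (- (p%:Z + 1 + val i)) by [].
have sgnnu i : if 0 < val i then 0 <= nu i else nu i <= 0.
  move: (pos i) (neg i); rewrite slopeE; case: ifP => _; [move=> _; apply|move=> h1' _; apply: h1'].
    by rewrite le_max lexx.
  by rewrite ge_min lexx.
have zero i : p%:Z < `|val i| -> nu i = 0.
  move=> ip; move: (pos i) (neg i); rewrite slopeE; case: i ip => i i0 /=; case: ifP => *; lia.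
have mono i j : prec i j -> nu j <= nu i.
  move=> ij; move: (prec_neq ij) => neq; move: (sgnnu i) (sgnnu j) (zero j) (zero i) (swap i j neq) ij.
  rewrite !slopeE precE; move: (nu i) (nu j) => a b.
  clear neq; case: i => i i0; case: j => j j0 /=; case: (ltP 0 i) => hi; case: (ltP 0 j) => hj //=; lia.
exists nu; split=> //; first by exists p.
move=> q i j y ij wy; apply/eqP; apply: contraT => y0; exfalso.
have neq := prec_neq ij.
have ws : is_weight (shift 1 i j nu) by exists (E q i j y) => //; apply: wt_E.
have ng := top_nogrow _ _ _ _ tnu neq ws.
have tp : top (shift 1 i j nu).
  by apply: top_shift => //; move: ng (mono _ _ ij); lia.
have := hmax _ tp; rewrite height_shift; have := mono _ _ ij.
move: (sgnnu i) (sgnnu j) (zero i) (zero j) ng ij; rewrite !slopeE precE.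
move: (nu i) (nu j) => a b.
clear -i j; case: i => i i0; case: j => j j0 /=; case: (ltP 0 i) => hi; case: (ltP 0 j) => hj //=; lia.
Qed.

End MaximalWeight.

(** * Singular vectors *)

Section HighestWeight.
Variables (K : numClosedFieldType) (U : lmodType K) (E : bool -> idx -> idx -> U -> U).
Hypothesis HE : is_action E.
Let El p i j : linear (E p i j) := HE.1 p i j.
Let Ebr := HE.2.
Let E0 p i j := lin_0 (El p i j).

Definition singular (nu : weight) (y : U) : Prop :=
  wt E nu y /\ forall q i j, prec i j -> E q i j y = 0.

Notation theta k := (E true k k).

Lemma singular_subspace nu : subspace (singular nu).
Proof.
split=> [|a u v [hu su] [hv sv]].
  by split=> [|q i j _]; [case: (wt_subspace HE nu)|rewrite E0].
split=> [|q i j ij]; first by apply: (wt_subspace HE nu).2.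
by rewrite El su // sv // scaler0 addr0.
Qed.

Lemma wt_diag p k nu y : wt E nu y -> wt E nu (E p k k y).
Proof. by move=> hy; apply: wt_eq (wt_E HE p k k hy) => l; rewrite /shift subrr mulr0 addr0. Qed.

Lemma singular_theta nu k y : singular nu y -> singular nu (theta k y).
Proof.
move=> [hy sy]; split=> [|q i j ij]; first exact: wt_diag.
rewrite Ebr sy // E0 scaler0 add0r.
have -> : (j == k)%:R *: E (q (+) true) i k y = 0.
  by case: eqP => [<-|_]; rewrite ?scale0r // sy // scaler0.
have -> : (sgn K (q && true) * (i == k)%:R) *: E (q (+) true) k j y = 0.
  by case: eqP => [<-|_]; rewrite ?mulr0 ?scale0r // sy // scaler0.
exact: subrr.
Qed.

Lemma theta_sq k y : theta k (theta k y) = E false k k y.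
Proof.
have /eqP := Ebr true true k k k k y.
rewrite /sgn /= eqxx expr1 mulr1 !scaleN1r scale1r opprK -subr_eq0 opprD opprK addrA.
rewrite -!mulr2n -mulrnBl -!scaler_nat scaler_eq0 pnatr_eq0 /= subr_eq0 => /eqP; exact.
Qed.

Lemma theta_anti k l y : k != l -> theta k (theta l y) = - theta l (theta k y).
Proof.
by move=> kl; rewrite Ebr /sgn /= (negbTE kl) mulr0 !scale0r subr0 addr0 expr1 scaleN1r.
Qed.

(** A repeated nonzero value of the weight would make the root vectors of
   indices i and j act by zero on the weight space: E false j i kills it by the
   theory of sl(2), hence so does its odd partner, and the anticommutator of the odd
   root vectors is h_i + h_j. *)
Lemma singular_strict nu y i j :
  (forall i j, i != j -> locally_nilpotent (E false i j)) ->
  (forall x, wt E nu x -> singular nu x) -> y != 0 -> wt E nu y ->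
  prec i j -> nu i = nu j -> nu i = 0.
Proof.
move=> nilE sing y0 hy ij nuij; have neq := prec_neq ij.
have neq' : j != i by rewrite eq_sym.
have low x : wt E nu x -> E false j i x = 0.
  move=> hx; have [_ sx] := sing x hx.
  apply: (@root_injective _ _ _ HE i j (shift 1 j i nu) _ 2 neq); first exact: nilE.
  - exact: wt_E.
  - by rewrite /shift !eqxx (negbTE neq) (negbTE neq') nuij; lia.
  - rewrite /= [E _ i j (E _ j i x)]Ebr sx // E0 scaler0 add0r /sgn /= !eqxx expr0 !mul1r !scale1r.
    by rewrite !hx nuij subrr E0.
have low1 : E true j i y = 0.
  have := Ebr true false i i j i y; rewrite low // E0 low; last exact: wt_diag.
  rewrite (negbTE neq) eqxx scale0r sub0r scaler0 add0r /sgn expr0 mulr1 scale1r.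
  by move/esym/eqP; rewrite oppr_eq0 => /eqP.
have [_ sy] := sing y hy.
have := Ebr true true i j j i y; rewrite low1 sy // !E0 scaler0 add0r !eqxx /sgn /= expr1 mulr1 scaleN1r opprK scale1r.
rewrite !hy nuij -scalerDl -rmorphD => /esym/eqP; rewrite scaler_eq0 (negbTE y0) orbF intr_eq0 => /eqP; lia.
Qed.

Lemma prec_total i j : ~~ prec j i -> i = j \/ prec i j.
Proof.
move=> h; have [->|neq] := eqVneq i j; [by left|right].
have {}neq : val i != val j by [].
move: h; rewrite /prec; case: i neq => i i0; case: j => j j0 /=.
by case: (ltP 0 i) => ?; case: (ltP 0 j) => ? //=; lia.
Qed.

Lemma prec_trans i j k : prec i j -> prec j k -> prec i k.
Proof.
rewrite /prec; case: i => i i0; case: j => j j0; case: k => k k0 /=.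
by case: (ltP 0 i) => ?; case: (ltP 0 j) => ?; case: (ltP 0 k) => ? //=; lia.
Qed.

Section Top.
Variables (nu : weight) (Q : U -> Prop).
Hypothesis Qsub : subspace Q.
Hypothesis Qsing : forall y, Q y -> singular nu y.
Hypothesis Qtheta : forall k y, Q y -> Q (theta k y).

(** Products of lowering operators applied to Q; by the triangular decomposition this
    is the whole module generated by Q. *)
Definition verma : U -> Prop := lspan (fun y => exists k, mon E (fun i j => prec j i) Q k y).

Lemma verma_E p i j m : verma m -> verma (E p i j m).
Proof.
apply: (mon_stable HE (L := fun _ _ => True)) => //; first exact: subspaceZ.
move=> {}p {}i {}j y _ /negP /prec_total [->|ij] Qy; last first.
  by rewrite (Qsing Qy).2 //; exact: lspan0.
apply: lspan_in; case: p; first exact: Qtheta.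
by rewrite (Qsing Qy).1; apply: subspaceZ.
Qed.

Lemma verma_subspace : subspace verma.
Proof.
apply: lspan_subspace => a y [k hy]; exists k.
by apply: (mon_scalable HE) hy; exact: subspaceZ.
Qed.

Lemma verma_in y : Q y -> verma y.
Proof. by move=> Qy; apply: lspan_in; exists 0%N; constructor. Qed.

(** Sums of positive roots are positive for the lexicographic order, hence nonzero. *)
Definition lex_pos (d : weight) : Prop := exists2 i, 0 < d i & forall j, prec j i -> d j = 0.

Lemma lex_pos_root d i j : (forall l, d l = 0) \/ lex_pos d -> prec j i -> lex_pos (shift 1 j i d).
Proof.
move=> hd ji; rewrite /lex_pos /shift.
have ne k l : prec k l -> (k == l) = false by move=> /prec_neq /negbTE.
have jcase : (forall k, prec k j -> d k = 0) -> 0 <= d j -> lex_pos (shift 1 j i d).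
  move=> dlow dj; exists j; rewrite /shift; first by rewrite eqxx ne //; lia.
  by move=> k kj; rewrite dlow // !ne //; exact: prec_trans ji.
case: hd => [d0|[l dl dlow]]; first by apply: jcase => [k _|]; rewrite d0.
have [lj|/prec_total[jl|jl]] := boolP (prec l j).
- exists l; first by rewrite !ne //; [lia|exact: prec_trans ji].
  move=> k kl; have kj := prec_trans kl lj; rewrite dlow // !ne //; exact: prec_trans ji.
- by apply: jcase; rewrite jl //; exact: ltW.
- by apply: jcase => [k kj|]; rewrite dlow //; exact: prec_trans jl.
Qed.

Lemma mon_weight k y : mon E (fun i j => prec j i) Q k y ->
  Q y \/ exists2 d, lex_pos d & wt E (fun i => nu i - d i) y.
Proof.
elim=> [{}y Qy|{}k p i j {}y ji _ IH]; [by left|right].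
have [d hd wy] : exists2 d, (forall l, d l = 0) \/ lex_pos d & wt E (fun i => nu i - d i) y.
  case: IH => [Qy|[d hd wy]]; last by exists d => //; right.
  exists (fun=> 0); first by left.
  by apply: wt_eq (Qsing Qy).1 => l; rewrite subr0.
exists (shift 1 j i d); first exact: lex_pos_root.
by apply: wt_eq (wt_E HE p i j wy) => l; rewrite /shift; lia.
Qed.

(** A nonempty product of lowering operators strictly lowers the weight, so only the
    empty product contributes to the weight nu. *)
Lemma verma_top z : verma z -> wt E nu z -> Q z.
Proof.
move=> hz wz.
pose N z := exists q s, [/\ Q q, forall y, y \in s -> exists2 mu, wt E mu y & exists i, mu i != nu i
  & z = q + \sum_(y <- s) y].
have Nsub : subspace N.
  split; first by exists 0, [::]; split; [case: Qsub|move=> y|rewrite big_nil addr0].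
  move=> a _ _ [q [s [Qq hs ->]]] [q' [s' [Qq' hs' ->]]].
  exists (a *: q + q'), ([seq a *: y | y <- s] ++ s'); split.
  - exact: Qsub.2.
  - move=> y; rewrite mem_cat => /orP[/mapP[x xs ->]|]; last exact: hs'.
    by have [mu hx neq] := hs x xs; exists mu => //; apply: (subspaceZ (wt_subspace HE mu)).
  - by rewrite big_cat big_map /= -scaler_sumr scalerDr addrACA.
have : N z.
  move: z hz {wz}; apply: lspan_ind => // y [k /mon_weight[Qy|[d [i di _] wy]]].
    by exists y, [::]; split=> //; rewrite big_nil addr0.
  exists 0, [:: y]; split; [by case: Qsub| |by rewrite big_seq1 add0r].
  move=> x; rewrite inE => /eqP ->; exists (fun i => nu i - d i) => //; exists i; lia.
case=> q [s [Qq hs zE]].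
have qz : z - q = \sum_(y <- s) y by rewrite zE addrC addKr.
have /eqP : \sum_(y <- s) y = 0.
  apply: (wt_independent HE (nu := nu)) => //; rewrite -qz.
  by apply: (subspaceB (wt_subspace HE nu)) => //; case: (Qsing Qq).
by rewrite -qz subr_eq0 => /eqP ->.
Qed.

End Top.

(** The vector theta_k v is killed by theta_k, hence so is the highest weight space of
    the module that it generates; if that module is everything, it contains v. *)
Lemma theta_kills nu v k : singular nu v -> nu k = 0 ->
  (theta k v != 0 -> generates E (theta k v)) -> theta k v = 0.
Proof.
move=> sv nk gen; apply/eqP; apply: contraT => x0.
pose Q y := singular nu y /\ theta k y = 0.
have sqk y : singular nu y -> theta k (theta k y) = 0.
  by move=> [wy _]; rewrite theta_sq wy nk scale0r.
have Qsub : subspace Q.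
  have [s0 sl] := singular_subspace nu.
  by split=> [|a u w [su tu] [sw tw]]; split; rewrite ?E0 ?El ?tu ?tw ?scaler0 ?addr0 //; apply: sl.
have Qtheta l y : Q y -> Q (theta l y).
  move=> [sy ty]; split; first exact: singular_theta.
  have [->|kl] := eqVneq l k; first exact: sqk.
  by rewrite theta_anti 1?eq_sym // ty E0 oppr0.
have Qsing y : Q y -> singular nu y by case.
have vQ : verma Q v.
  apply: (gen x0 _ (verma_subspace Qsub)); first exact: (verma_E Qsub Qsing Qtheta).
  by apply: verma_in; split; [exact: singular_theta|exact: sqk].
by have [_ tv] := verma_top Qsub Qsing vQ sv.1; rewrite tv eqxx in x0.
Qed.

End HighestWeight.

(** * The odd part of the Cartan subalgebra *)

Lemma pair_ind (T : Type) (P : seq T -> Prop) : P [::] -> (forall i, P [:: i]) ->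
  (forall i j s, P s -> P (i :: j :: s)) -> forall s, P s.
Proof.
move=> P0 P1 P2 s; suff : P s /\ forall i, P (i :: s) by case.
by elim: s => [|j s [Ps IH]]; split => // i; apply: P2.
Qed.

Section Clifford.
Variables (K : numClosedFieldType) (U : lmodType K) (E : bool -> idx -> idx -> U -> U).
Hypothesis HE : is_action E.
Variable nu : weight.
Let El p i j : linear (E p i j) := HE.1 p i j.
Let E0 p i j := lin_0 (El p i j).
Let EZ p i j := lin_Z (El p i j).
Let ED p i j := lin_D (El p i j).

Notation theta k := (E true k k).
Notation sing := (singular E nu).

Lemma theta_sq_sing k y : sing y -> theta k (theta k y) = (nu k)%:~R *: y.
Proof. by move=> [wy _]; rewrite theta_sq // wy. Qed.

Definition kappa (i j : idx) : K := sqrtC (- (nu j)%:~R / (nu i)%:~R).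

(** An isotropic vector of the Clifford algebra: on vectors of weight nu, theta_i has
    square nu_i, and kappa is chosen so that psi squares to zero. *)
Definition psi (i j : idx) (y : U) : U := theta j y - kappa i j *: theta i y.

Lemma kappa_sq i j : nu i != 0 -> kappa i j ^+ 2 * (nu i)%:~R = - (nu j)%:~R.
Proof. by move=> ni; rewrite sqrtCK mulfVK // intr_eq0. Qed.

Lemma kappa_neq0 i j : nu i != 0 -> nu j != 0 -> kappa i j != 0.
Proof.
move=> ni nj; rewrite sqrtC_eq0 mulf_eq0 oppr_eq0 invr_eq0 !intr_eq0.
by rewrite negb_or ni nj.
Qed.

Lemma psi_linear i j : linear (psi i j).
Proof.
by move=> a u v; rewrite /psi !El !scalerDr opprD addrACA scalerN !scalerA [kappa i j * a]mulrC.
Qed.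

Lemma psi_theta i j l y : i != l -> j != l -> psi i j (theta l y) = - theta l (psi i j y).
Proof.
move=> il jl; rewrite /psi ED -!scaleNr EZ (theta_anti HE _ il) (theta_anti HE _ jl).
by rewrite !scaleNr scalerN opprD !opprK.
Qed.

Lemma psi_comb i j u v k l : psi i j (u - kappa k l *: v) = psi i j u - kappa k l *: psi i j v.
Proof. by rewrite (lin_D (psi_linear i j)) -scaleNr (lin_Z (psi_linear i j)) scaleNr. Qed.

Lemma psi_anti i j k l y : i != k -> j != k -> i != l -> j != l ->
  psi i j (psi k l y) = - psi k l (psi i j y).
Proof.
move=> ik jk il jl; have -> : psi k l y = theta l y - kappa k l *: theta k y by [].
rewrite psi_comb psi_theta // psi_theta // scalerN opprK.
by have -> : psi k l (psi i j y) = theta l (psi i j y) - kappa k l *: theta k (psi i j y) by []; rewrite opprB addrC.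
Qed.

Lemma psi_sq i j y : i != j -> nu i != 0 -> sing y -> psi i j (psi i j y) = 0.
Proof.
move=> ij ni sy; have -> : psi i j (psi i j y) = psi i j (theta j y) - kappa i j *: psi i j (theta i y).
  exact: psi_comb.
have ji : j != i by rewrite eq_sym.
rewrite /psi !theta_sq_sing // (theta_anti HE _ ji) scalerBr scalerN !scalerA -expr2 kappa_sq //.
by rewrite scaleNr opprK opprD opprK addrA subrK subrr.
Qed.

Lemma psi_sing i j y : sing y -> sing (psi i j y).
Proof.
move=> sy; have hs := singular_subspace HE nu.
by apply: subspaceB => //; [|apply: subspaceZ => //]; apply: singular_theta.
Qed.

(** The indices of s are taken in consecutive pairs, so that the psi of the pairs
    span a maximal isotropic subspace; a last index may remain unpaired. *)
Fixpoint pure (s : seq idx) (y : U) : Prop :=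
  match s with i :: j :: s' => psi i j y = 0 /\ pure s' y | _ => True end.

Lemma pure_psi s i j y : i \notin s -> j \notin s -> pure s y -> pure s (psi i j y).
Proof.
elim/pair_ind: s => // k l s IH; rewrite !inE !negb_or => /and3P[ik il is_] /and3P[jk jl js].
move=> [h hs]; split; last exact: IH.
by rewrite psi_anti 1?eq_sym // h (lin_0 (psi_linear i j)) oppr0.
Qed.

(** As psi squares to zero, either psi kills u or psi u is a nonzero vector killed by
    psi; the operators of different pairs anticommute. *)
Lemma pure_exists (P : U -> Prop) s y : uniq s -> (forall i, i \in s -> nu i != 0) ->
  (forall z, P z -> sing z) -> (forall i j z, P z -> P (psi i j z)) ->
  P y -> y != 0 -> exists u, [/\ u != 0, P u & pure s u].
Proof.
move=> us ns Ps Ppsi Py y0; elim/pair_ind: s us ns => [|i|i j s IH]; try by exists y.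
rewrite /= inE negb_or => /and3P[/andP[ij is_] js us] ns.
have [//||u [u0 Pu pu]] := IH; first by move=> k ks; apply: ns; rewrite !inE ks !orbT.
have [p0|p0] := eqVneq (psi i j u) 0; first by exists u.
exists (psi i j u); split=> //=; first exact: Ppsi.
split; last exact: pure_psi.
by apply: psi_sq => //; [apply: ns; rewrite mem_head|exact: Ps].
Qed.

Variable w : U.

(** For w pure, this is the module generated by w over the odd Cartan elements of index
    in s: on vectors killed by psi i j, theta_j acts as a multiple of theta_i. *)
Fixpoint spinors (s : seq idx) : U -> Prop :=
  match s with
  | [::] => fun y => exists a, y = a *: w
  | [:: k] => fun y => exists a b, y = a *: w + b *: theta k w
  | i :: j :: s' => fun y => exists y1 y2, [/\ spinors s' y1, spinors s' y2 & y = y1 + theta i y2]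
  end.

Lemma spinors_subspace s : subspace (spinors s).
Proof.
elim/pair_ind: s => [|k|i j s [S0 Sl]] /=.
- split; first by exists 0; rewrite scale0r.
  by move=> a _ _ [b ->] [c ->]; exists (a * b + c); rewrite scalerDl scalerA.
- split; first by exists 0, 0; rewrite !scale0r addr0.
  move=> a _ _ [b [c ->]] [d [e ->]]; exists (a * b + d), (a * c + e).
  by rewrite !scalerDl !scalerDr !scalerA addrACA.
- split; first by exists 0, 0; rewrite E0 addr0.
  move=> a _ _ [y1 [y2 [h1 h2 ->]]] [z1 [z2 [g1 g2 ->]]].
  exists (a *: y1 + z1), (a *: y2 + z2); split; [exact: Sl|exact: Sl|].
  by rewrite El scalerDr addrACA.
Qed.

Lemma spinors_in s : spinors s w.
Proof.
elim/pair_ind: s => [|k|i j s IH] /=.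
- by exists 1; rewrite scale1r.
- by exists 1, 0; rewrite scale1r scale0r addr0.
- by exists w, 0; rewrite E0 addr0; split=> //; case: (spinors_subspace s).
Qed.

Hypothesis sw : sing w.

Lemma spinors_sing s y : spinors s y -> sing y.
Proof.
have hs := singular_subspace HE nu.
elim/pair_ind: s y => [|k|i j s IH] y /=.
- by move=> [a ->]; apply: subspaceZ.
- by move=> [a [b ->]]; apply: subspaceD => //; apply: subspaceZ => //; apply: singular_theta.
- by move=> [y1 [y2 [/IH h1 /IH h2 ->]]]; apply: subspaceD => //; apply: singular_theta.
Qed.

Lemma spinors_kill (g : U -> U) s : linear g -> g w = 0 ->
  (forall k y, k \in s -> g (theta k y) = - theta k (g y)) -> forall y, spinors s y -> g y = 0.
Proof.
move=> gl gw; elim/pair_ind: s => [|k|i j s IH] gt y /=.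
- by move=> [a ->]; rewrite (lin_Z gl) gw scaler0.
- move=> [a [b ->]]; rewrite (lin_D gl) !(lin_Z gl) gt ?mem_head // gw E0 oppr0 !scaler0.
  exact: addr0.
- move=> [y1 [y2 [h1 h2 ->]]].
  have gt' k z : k \in s -> g (theta k z) = - theta k (g z).
    by move=> ks; apply: gt; rewrite !inE ks !orbT.
  by rewrite (lin_D gl) gt ?mem_head // (IH gt' _ h1) (IH gt' _ h2) E0 oppr0 addr0.
Qed.

Lemma spinors_psi s i j y : i \notin s -> j \notin s -> psi i j w = 0 -> spinors s y -> psi i j y = 0.
Proof.
move=> is_ js pw; apply: spinors_kill => // [|k z ks]; first exact: psi_linear.
by rewrite psi_theta //; [apply: contraNneq is_ => ->|apply: contraNneq js => ->].
Qed.

Lemma spinors_theta s k y : uniq s -> (forall i, i \in s -> nu i != 0) -> pure s w ->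
  k \in s -> spinors s y -> spinors s (theta k y).
Proof.
elim/pair_ind: s k y => [|l|i j s IH] k y //=.
  move=> _ _ _; rewrite inE => /eqP -> [a [b ->]]; exists (b * (nu l)%:~R), a.
  by rewrite ED !EZ theta_sq_sing // scalerA addrC.
rewrite inE negb_or => /and3P[/andP[ij is_] js us] ns [pw ps].
have [S0 Sl] := spinors_subspace s.
have thj z : spinors s z -> theta j z = kappa i j *: theta i z.
  by move=> /(spinors_psi is_ js pw)/eqP; rewrite subr_eq0 => /eqP.
move=> kin [y1 [y2 [h1 h2 ->]]].
have SZ a z : spinors s z -> spinors s (a *: z) by apply: subspaceZ.
have [->|ki] := eqVneq k i.
  exists ((nu i)%:~R *: y2), y1; split=> //; first exact: SZ.
  by rewrite ED (theta_sq_sing i (spinors_sing h2)) addrC.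
have [->|kj] := eqVneq k j.
  exists (- (kappa i j * (nu i)%:~R) *: y2), (kappa i j *: y1); split; try exact: SZ.
  rewrite ED thj // (theta_anti HE) 1?eq_sym // thj // EZ (theta_sq_sing i (spinors_sing h2)).
  by rewrite EZ scaleNr scalerA addrC.
have ks : k \in s by move: kin; rewrite !inE (negbTE ki) (negbTE kj).
have ns' l : l \in s -> nu l != 0 by move=> ls; apply: ns; rewrite !inE ls !orbT.
exists (theta k y1), (- theta k y2); split; try exact: IH.
  by rewrite -scaleN1r; apply/SZ/IH.
by rewrite ED (theta_anti HE _ ki) -[- theta k y2]scaleN1r EZ scaleN1r.
Qed.

(** If psi kills x = y1 + theta_i y2, where it kills y1 and y2, then it kills
    theta_i y2; but psi theta_i y2 = - 2 kappa nu_i y2, so y2 = 0. *)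
Lemma spinors_pure s x : uniq s -> (forall i, i \in s -> nu i != 0) -> pure s w ->
  spinors s x -> pure s x -> exists a b k, x = a *: w + b *: theta k w.
Proof.
elim/pair_ind: s x => [|l|i j s IH] x /=.
- move=> _ _ _ [a ->] _; have [k _] := fresh [::]; exists a, 0, k.
  by rewrite scale0r addr0.
- by move=> _ _ _ [a [b ->]] _; exists a, b, l.
rewrite inE negb_or => /and3P[/andP[ij is_] js us] ns [pw ps] [y1 [y2 [h1 h2 xE]]] [px hx].
have ni : nu i != 0 by apply: ns; rewrite mem_head.
have nj : nu j != 0 by apply: ns; rewrite !inE eqxx orbT.
have py2 := spinors_psi is_ js pw h2.
have : psi i j (theta i y2) = 0.
  by move: px; rewrite xE (lin_D (psi_linear i j)) (spinors_psi is_ js pw h1) add0r.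
rewrite /psi (theta_anti HE) 1?eq_sym //.
have -> : theta j y2 = kappa i j *: theta i y2 by move/eqP: py2; rewrite subr_eq0 => /eqP.
rewrite EZ !(theta_sq_sing i (spinors_sing h2)) -opprD -mulr2n => /eqP.
rewrite oppr_eq0 -scaler_nat !scaler_eq0 pnatr_eq0 /= intr_eq0 (negbTE ni) (negbTE (kappa_neq0 ni nj)) /=.
move=> /eqP y20; move: hx; rewrite xE y20 E0 addr0 => hx.
by apply: IH => // l ls; apply: ns; rewrite !inE ls !orbT.
Qed.

End Clifford.

(** * Modules generated by singular vectors *)

Section Modules.
Variable K : numClosedFieldType.

Definition op (M : qmodule K) (p : bool) (i j : idx) (m : M) : M := act (EF K p i j) m.

Lemma act0l (M : qmodule K) (m : M) : act 0 m = 0.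
Proof. by have := act_linl (-1) (0 : q K) 0 m; rewrite !scaleN1r oppr0 addr0 addNr. Qed.

Lemma op_action (M : qmodule K) : is_action (@op M).
Proof.
split=> [p i j a u v|p r i j k l m]; first exact: act_linr.
rewrite /op.
pose Z : q K := (j == k)%:R *: EF K (p (+) r) i l - (sgn K (p && r) * (i == l)%:R) *: EF K (p (+) r) k j.
have valZ : val Z = supercomm p r (val (EF K p i j)) (val (EF K r k l)).
  by apply: funext => t; rewrite /= ef_supercomm.
have /esym/eqP := @act_br _ M p r (EF K p i j) (EF K r k l) Z m (ef_hom K p i j) (ef_hom K r k l) valZ.
rewrite subr_eq => /eqP ->; rewrite addrC; congr (_ + _).
rewrite /Z act_linl -!scaleNr; congr (_ + _).
by rewrite -[in LHS](addr0 (_ *: _)) act_linl act0l addr0.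
Qed.

Lemma op_par (M : qmodule K) p r i j (m : M) : par r m -> par (p (+) r) (op p i j m).
Proof. by move=> rm; apply: act_par => //; exact: ef_hom. Qed.

Lemma op_closed (M : qmodule K) (N : M -> Prop) : subspace N ->
  (forall p i j m, N m -> N (op p i j m)) -> forall X m, N m -> N (act X m).
Proof.
move=> Nsub Nop X m Nm; have [s [_ ->]] := EF_span X.
elim: s => [|t s IH]; first by rewrite big_nil act0l; case: Nsub.
by rewrite big_cons act_linl; apply: Nsub.2 => //; exact: Nop.
Qed.

Definition gensub (M : qmodule K) (v m : M) : Prop := forall N : M -> Prop, subspace N ->
  (forall p i j m, N m -> N (op p i j m)) -> N v -> N m.

Lemma gensub_subspace M v : subspace (@gensub M v).
Proof.
split=> [N Nsub _ _|a u w hu hw N Nsub Nop Nv]; first by case: Nsub.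
by apply: Nsub.2; [apply: hu|apply: hw].
Qed.

Lemma gensub_op M v p i j m : @gensub M v m -> @gensub M v (op p i j m).
Proof. by move=> hm N Nsub Nop Nv; apply: (Nop); apply: hm. Qed.

Lemma gensub_in M v : @gensub M v v.
Proof. by move=> N. Qed.

Lemma par_subspace (M : superSpace K) p : subspace (@par K M p).
Proof. by case: (par_grading M) => p0 pl _ _; split=> //; exact: pl. Qed.

Lemma par_disjoint (M : superSpace K) (a b c d : M) : par false a -> par false c ->
  par true b -> par true d -> a + b = c + d -> a = c /\ b = d.
Proof.
move=> pa pc pb pd e; have ac : a - c = d - b.
  by apply/eqP; rewrite subr_eq addrAC eq_sym subr_eq e addrC.
have [_ _ _ pI] := par_grading M.
have h : a - c = 0.
  apply: pI; first exact: (subspaceB (par_subspace M false)).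
  by rewrite ac; apply: (subspaceB (par_subspace M true)).
split; apply/eqP; first by rewrite -subr_eq0 h.
by rewrite eq_sym -subr_eq0 -ac h.
Qed.

(** For homogeneous v, the vectors whose two components are both generated by v form a
    subspace that is stable under the basis elements and contains v. *)
Lemma gensub_submodule (M : qmodule K) p (v : M) : par p v -> is_submodule (gensub v).
Proof.
move=> pv; have [g0 gl] := gensub_subspace v.
split=> // [m0 m1 p0 p1 hm|]; last by apply: op_closed => // *; exact: gensub_op.
have P0 r : par r (0 : M) by case: (par_subspace M r).
have Pl r a (x y : M) : par r x -> par r y -> par r (a *: x + y).
  by move=> hx hy; apply: (par_subspace M r).2.
pose N m := exists n0 n1 : M, [/\ par false n0, par true n1, gensub v n0, gensub v n1 & m = n0 + n1].
have : N (m0 + m1).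
  apply: hm.
  - split; first by exists 0, 0; split; rewrite ?addr0 //; exact: P0.
    move=> a _ _ [n0 [n1 [q0 q1 h0 h1 ->]]] [n0' [n1' [q0' q1' h0' h1' ->]]].
    exists (a *: n0 + n0'), (a *: n1 + n1').
    split; try exact: gl; try exact: Pl.
    by rewrite scalerDr addrACA.
  - move=> r i j _ [n0 [n1 [q0 q1 h0 h1 ->]]].
    have E := lin_D ((op_action M).1 r i j) n0 n1.
    case: r E => E.
      exists (op true i j n1), (op true i j n0).
      split; [exact: (op_par true i j q1)|exact: (op_par true i j q0)|exact: gensub_op..|].
      by rewrite E addrC.
    exists (op false i j n0), (op false i j n1).
    by split; [exact: (op_par false i j q0)|exact: (op_par false i j q1)|exact: gensub_op..|].
  - have vin := @gensub_in M v.
    by case: p pv => pv; [exists 0, v|exists v, 0]; split; rewrite ?add0r ?addr0 //; exact: P0.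
move=> [n0 [n1 [q0 q1 h0 h1 e]]].
by have [-> ->] := par_disjoint p0 q0 p1 q1 e.
Qed.

Lemma simple_generates (M : qmodule K) p (v : M) : simple_module M -> par p v -> v != 0 ->
  generates (@op M) v.
Proof.
move=> [_ hM] pv v0 N Nsub Nop Nv m.
have [h|h] := hM _ (gensub_submodule pv); last exact: h.
by move/eqP: v0; case; apply: h; exact: gensub_in.
Qed.

Section Product.
Variables M N : qmodule K.

Definition prod_par (p : bool) (z : M * N) : Prop := par p z.1 /\ par p z.2.

Fact prod_grading : is_grading prod_par.
Proof.
have [m0 ml md mi] := par_grading M; have [n0 nl nd ni] := par_grading N.
split=> [p|p a u v [? ?] [? ?]|[x y]|[x y] [/= ? ?] [/= ? ?]].
- by split; [exact: m0|exact: n0].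
- by split; [exact: ml|exact: nl].
- have [x0 [x1 [? ? ->]]] := md x; have [y0 [y1 [? ? ->]]] := nd y.
  by exists (x0, y0), (x1, y1).
- by congr pair; [exact: mi|exact: ni].
Qed.

Definition prod_space : superSpace K := SuperSpace prod_grading.

Definition prod_act (X : q K) (z : prod_space) : prod_space := (act X z.1, act X z.2).

Fact prod_act_linl a X Y m : prod_act (a *: X + Y) m = a *: prod_act X m + prod_act Y m.
Proof. by rewrite /prod_act !act_linl. Qed.
Fact prod_act_linr a X m m' : prod_act X (a *: m + m') = a *: prod_act X m + prod_act X m'.
Proof. by rewrite /prod_act !act_linr. Qed.
Fact prod_act_par p r X (m : prod_space) : qpar p X -> par r m -> par (p (+) r) (prod_act X m).
Proof. by move=> hX [? ?]; split; apply: act_par. Qed.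
Fact prod_act_br p r X Y Z m : qpar p X -> qpar r Y ->
  val Z = supercomm p r (val X) (val Y) ->
  prod_act Z m = prod_act X (prod_act Y m) - sgn K (p && r) *: prod_act Y (prod_act X m).
Proof.
move=> hX hY hZ; rewrite /prod_act (act_br _ hX hY hZ) (act_br _ hX hY hZ).
by [].
Qed.

Definition prod_module : qmodule K :=
  QModule prod_act_linl prod_act_linr prod_act_par prod_act_br.
End Product.

(** The submodule G of M + N generated by (u, u') projects onto both simple modules. Its
    intersections with M and N are submodules, each zero or everything; if one of
    them is everything, then G contains (0, u'). *)
Lemma graph_isomorphism (M N : qmodule K) p (u : M) (u' : N) :
  simple_module M -> simple_module N -> par p u -> par p u' -> u != 0 -> u' != 0 ->
  ~ @gensub (prod_module M N) (u, u') (0, u') -> isomorphic M N.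
Proof.
move=> sM sN pu pu' u0 u0' ngen; pose G := @gensub (prod_module M N) (u, u').
have pw : @par _ (prod_module M N) p (u, u') by [].
have [G0 Gl Ggr Gact] : is_submodule G := gensub_submodule pw.
have Gu : G (u, u') by exact: gensub_in.
have pM0 q : par q (0 : M) by case: (par_subspace M q).
have pN0 q : par q (0 : N) by case: (par_subspace N q).
have Ggr2 (m0 m1 : M) (n0 n1 : N) : par false m0 -> par true m1 -> par false n0 -> par true n1 ->
    G (m0 + m1, n0 + n1) -> G (m0, n0) /\ G (m1, n1).
  by move=> ? ? ? ?; apply: (Ggr (m0, n0) (m1, n1)).
have sub_hits N' : is_submodule N' -> (exists2 m : M, N' m & m != 0) -> forall m, N' m.
  by move=> hN [m Nm m0]; have [/(_ m Nm) e|//] := sM.2 _ hN; rewrite e eqxx in m0.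
have sub_hits' N' : is_submodule N' -> (exists2 m : N, N' m & m != 0) -> forall m, N' m.
  by move=> hN [m Nm m0]; have [/(_ m Nm) e|//] := sN.2 _ hN; rewrite e eqxx in m0.
have actM0 X : act X (0 : M) = 0 by exact: (lin_0 (fun a u v => act_linr a X u v)).
have actN0 X : act X (0 : N) = 0 by exact: (lin_0 (fun a u v => act_linr a X u v)).
have decM := fun m => let: And4 _ _ d _ := par_grading M in d m.
have decN := fun m => let: And4 _ _ d _ := par_grading N in d m.
have onto m : exists n, G (m, n).
  apply: (sub_hits (fun m => exists n, G (m, n))); last by exists u => //; exists u'.
  split; first by exists 0.
  - by move=> a m1 m2 [n1 h1] [n2 h2]; exists (a *: n1 + n2); exact: (Gl a (m1, n1) (m2, n2)).
  - move=> m0 m1 p0 p1 [n]; have [n0 [n1 [q0 q1 ->]]] := decN n.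
    by move=> /Ggr2[//|//|//|//|h0 h1]; split; [exists n0|exists n1].
  - by move=> X m1 [n1 h1]; exists (act X n1); exact: (Gact X (m1, n1)).
have onto' n : exists m, G (m, n).
  apply: (sub_hits' (fun n => exists m, G (m, n))); last by exists u' => //; exists u.
  split; first by exists 0.
  - by move=> a m1 m2 [n1 h1] [n2 h2]; exists (a *: n1 + n2); exact: (Gl a (n1, m1) (n2, m2)).
  - move=> n0 n1 p0 p1 [m]; have [m0 [m1 [q0 q1 ->]]] := decM m.
    by move=> /Ggr2[//|//|//|//|h0 h1]; split; [exists m0|exists m1].
  - by move=> X m1 [n1 h1]; exists (act X n1); exact: (Gact X (n1, m1)).
have inj' n : G (0, n) -> n = 0.
  have hs : is_submodule (fun n => G (0, n)).
    split=> //.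
    - move=> a n1 n2 h1 h2; have := Gl a _ _ h1 h2; congr G.
      by congr pair; rewrite /= scaler0 addr0.
    - by move=> n0 n1 p0 p1 h; apply: Ggr2 => //; rewrite addr0.
    - by move=> X n1 /(Gact X); rewrite /act /= /prod_act /= actM0.
  by have [h|h] := sN.2 _ hs; [exact: h|case: ngen; exact: h].
have inj m : G (m, 0) -> m = 0.
  have hs : is_submodule (fun m => G (m, 0)).
    split=> //.
    - move=> a n1 n2 h1 h2; have := Gl a _ _ h1 h2; congr G.
      by congr pair; rewrite /= scaler0 addr0.
    - by move=> n0 n1 p0 p1 h; apply: Ggr2 => //; rewrite addr0.
    - by move=> X n1 /(Gact X); rewrite /act /= /prod_act /= actN0.
  have [h|h] := sM.2 _ hs; first exact: h.
  case: ngen; have := Gl (-1) _ _ (h u) Gu; congr G.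
  by congr pair; rewrite /= ?scaler0 ?add0r // scaleN1r addNr.
have GB m n m' n' : G (m, n) -> G (m', n') -> G (m - m', n - n').
  move=> h h'; have := Gl (-1) _ _ h' h; congr G.
  by congr pair; rewrite /= scaleN1r addrC.
have fun1 m n n' : G (m, n) -> G (m, n') -> n = n'.
  by move=> h /(GB _ _ _ _ h); rewrite subrr => /inj'/eqP; rewrite subr_eq0 => /eqP.
have fun2 m m' n : G (m, n) -> G (m', n) -> m = m'.
  by move=> h /(GB _ _ _ _ h); rewrite subrr => /inj/eqP; rewrite subr_eq0 => /eqP.
have [f fP] := choice onto; have [g gP] := choice onto'.
exists f; split.
- by move=> a m m'; apply: fun1 (fP _) (Gl a _ _ (fP m) (fP m')).
- exists g => x; [exact: fun2 (gP _) (fP x)|exact: fun1 (fP _) (gP x)].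
- move=> q m qm; have [n0 [n1 [q0 q1 nE]]] := decN (f m); have := fP m; rewrite nE.
  case: q qm => qm.
    rewrite -[X in G (X, _)]add0r => /Ggr2[//|//|//|//|h0 h1].
    by rewrite -nE (fun1 _ _ _ (fP m) h1).
  rewrite -[X in G (X, _)]addr0 => /Ggr2[//|//|//|//|h0 h1].
  by rewrite -nE (fun1 _ _ _ (fP m) h0).
- by move=> X m; apply: fun1 (fP _) (Gact X _ (fP m)).
Qed.

(** The highest weight space of the submodule generated by (u, u') consists of the
    spinors on (u, u'). If (0, u') were among them, it would be
    a (u, u') + b theta_k (u, u') since it is pure, and the components of its parity
    give a u = 0 and a u' = u'. *)
Lemma pure_isomorphism (M N : qmodule K) p (u : M) (u' : N) nu s :
  simple_module M -> simple_module N -> par p u -> par p u' -> u != 0 -> u' != 0 ->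
  uniq s -> (forall i, i \in s = (nu i != 0)) ->
  singular (@op M) nu u -> singular (@op N) nu u' ->
  pure (@op M) nu s u -> pure (@op N) nu s u' -> isomorphic M N.
Proof.
move=> sM sN pu pu' u0 u0' us sP su su' hu hu'.
apply: (graph_isomorphism sM sN pu pu') => // gen.
pose w : prod_module M N := (u, u').
have HP := op_action (prod_module M N).
have spair (a : M) (b : N) : singular (@op M) nu a -> singular (@op N) nu b ->
    singular (@op (prod_module M N)) nu (a, b).
  move=> [wa sa] [wb sb]; split=> [i|r i j ij].
    by congr pair; [exact: wa|exact: wb].
  by congr pair; [exact: sa|exact: sb].
have ppair (a : M) (b : N) t : pure (@op M) nu t a -> pure (@op N) nu t b ->
    pure (@op (prod_module M N)) nu t (a, b).
  elim/pair_ind: t => // i j t IH [pa ha] [pb hb]; split; last exact: IH.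
  by congr pair; [exact: pa|exact: pb].
have sing0 (L : qmodule K) : singular (@op L) nu 0 by case: (singular_subspace (op_action L) nu).
have pure0 (L : qmodule K) t : pure (@op L) nu t 0.
  by elim/pair_ind: t => // i j t IH; split=> //; exact: (lin_0 (psi_linear (op_action L) _ _ _)).
have sw : singular (@op (prod_module M N)) nu w by exact: spair.
have ns i : i \in s -> nu i != 0 by rewrite sP.
have kill (L : qmodule K) r (v : L) k : simple_module L -> par r v -> singular (@op L) nu v ->
    k \notin s -> op true k k v = 0.
  move=> sL pv sv; rewrite sP negbK => /eqP nk.
  apply: (theta_kills (op_action L) sv nk) => v0.
  by apply: simple_generates v0 => //; exact: op_par pv.
have Qsub := spinors_subspace HP w s.
have Qsing y : spinors (@op _) w s y -> singular (@op _) nu y by apply: spinors_sing.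
have Qtheta k y : spinors (@op _) w s y -> spinors (@op _) w s (op true k k y).
  have [ks|ks] := boolP (k \in s).
    by apply: (spinors_theta HP sw) => //; exact: ppair.
  move=> hy; rewrite (spinors_kill HP (HP.1 true k k) _ _ hy); first by case: Qsub.
    by congr pair; apply: kill ks; [exact: sM|exact: pu|exact: su|exact: sN|exact: pu'|exact: su'].
  by move=> l z ls; rewrite (theta_anti HP) //; apply: contraNneq ks => ->.
have vG : verma (@op _) (spinors (@op _) w s) (0, u').
  apply: (gen _ (verma_subspace HP Qsub)); first exact: (verma_E HP Qsub Qsing Qtheta).
  by apply: verma_in; exact: spinors_in.
have x0 : spinors (@op _) w s (0, u').
  by apply: (verma_top HP Qsub Qsing vG); case: (spair 0 u').
have [a [b [k xE]]] := spinors_pure HP sw us ns (ppair _ _ _ hu hu') x0 (ppair _ _ _ (pure0 _ _) hu').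
have eM : 0 = a *: u + b *: op true k k u by exact: (congr1 fst xE).
have eN : u' = a *: u' + b *: op true k k u' by exact: (congr1 snd xE).
have opp_par (L : qmodule K) (x y z : L) : par p x -> par p z -> par (~~ p) y -> x = z + y -> x = z.
  move=> px pz py e; have [_ _ _ pI] := par_grading L.
  suff y0 : y = 0 by rewrite e y0 addr0.
  have py' : par p y by rewrite -[y](addKr z) -e addrC; apply: (subspaceB (par_subspace L p)).
  by case: (p) py py' => ? ?; apply: pI.
have /esym/eqP : 0 = a *: u.
  apply: (opp_par M _ (b *: op true k k u)) => //; first by case: (par_subspace M p).
    exact: subspaceZ (par_subspace M p) _ _ pu.
  by apply: (subspaceZ (par_subspace M _)); have := op_par true k k pu; rewrite addTb.
rewrite scaler_eq0 (negbTE u0) orbF => /eqP a0.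
have : u' = a *: u'.
  apply: (opp_par N _ (b *: op true k k u')) => //; first exact: subspaceZ (par_subspace N p) _ _ pu'.
  by apply: (subspaceZ (par_subspace N _)); have := op_par true k k pu'; rewrite addTb.
by rewrite a0 scale0r => e; rewrite e eqxx in u0'.
Qed.

End Modules.

(** * Classification of the simple modules *)

Lemma strict_partition_of (a : nat -> nat) : (exists k, a k = 0%N) ->
  (forall k, a k.+1 != 0%N -> (a k.+1 < a k)%N) ->
  exists2 lam, strict_partition lam & forall k, nth 0%N lam k = a k.
Proof.
move=> [k0 ak0] dec; have ex : exists k, a k == 0%N by exists k0; apply/eqP.
case: (ex_minnP ex) => c /eqP ac cmin.
have a0 k : (c <= k)%N -> a k = 0%N.
  move=> /subnK <-; elim: (k - c)%N => // n IH; rewrite addSn; apply/eqP.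
  by apply: contraT => /dec; rewrite IH.
have an k : (k < c)%N -> a k != 0%N.
  by move=> kc; apply: contraTneq kc => /eqP /cmin; rewrite -leqNgt.
exists (mkseq a c).
  apply/andP; split.
    apply/(sortedP 0%N) => i; rewrite size_mkseq => ic.
    by rewrite !nth_mkseq ?(ltnW ic) //; apply/dec/an.
  by apply/negP => /mapP[k]; rewrite mem_iota => kc e; have := an k kc; rewrite -e.
move=> k; have [kc|ck] := ltnP k c; first by rewrite nth_mkseq.
by rewrite nth_default ?size_mkseq // a0.
Qed.

Lemma eigenvector_exists (K : numFieldType) (U : lmodType K) (h : U -> U) (P : U -> Prop) ks m :
  (forall k y, P y -> P (h y - k *: y)) -> P m -> m != 0 -> hpoly h ks m = 0 ->
  exists2 y, P y & y != 0 /\ exists k : int, h y = k%:~R *: y.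
Proof.
move=> hP Pm m0; elim: ks => [|k ks IH] /= hm; first by rewrite hm eqxx in m0.
have Pk : P (hpoly h ks m) by elim: ks {IH hm} => [|l ks IH] //=; apply: hP.
have [e|e] := eqVneq (hpoly h ks m) 0; first exact: IH.
exists (hpoly h ks m) => //; split=> //; exists k; apply/eqP; rewrite -subr_eq0; exact/eqP.
Qed.

Section Existence.
Variables (K : numClosedFieldType) (M : qmodule K).

Lemma integrable_nilpotent i j : integrable M -> i != j -> locally_nilpotent (@op K M false i j).
Proof.
move=> intM ij m; pose n := (`|val i| + `|val j|).*2.
have n0 : (0 < n)%N by rewrite /n; case: (i) => k /=; lia.
have [rep lift] := intM n n0.
have inI (l : idx) : (`|val l| <= `|val i| + `|val j|)%N -> exists k : 'I_n, l = I_enum k.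
  move=> le; apply/I_enumP; rewrite /in_I /n uphalf_double doubleK; lia.
have [k ik] := inI i (leq_addr _ _); have [l jl] := inI j (leq_addl _ _).
rewrite /op ik jl; apply: (root_vector_nilpotent lift).
by apply: contraNneq ij => kl; rewrite ik jl kl.
Qed.

Lemma op_torus i j (m : M) : op false i i (op false j j m) = op false j j (op false i i m).
Proof.
rewrite (op_action M).2 /sgn expr0 !scale1r mul1r.
by case: eqP => [->|_]; rewrite ?scale0r subrr addr0.
Qed.

Lemma homogeneous_weight nu (y : M) : y != 0 -> wt (@op K M) nu y ->
  exists q x, [/\ x != 0, par q x & wt (@op K M) nu x].
Proof.
move=> y0 wy; have [_ _ dec _] := par_grading M.
have [x0 [x1 [p0 p1 yE]]] := dec y.
have w01 : wt (@op K M) nu x0 /\ wt (@op K M) nu x1.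
  suff h i : op false i i x0 = (nu i)%:~R *: x0 /\ op false i i x1 = (nu i)%:~R *: x1.
    by split=> i; case: (h i).
  apply: par_disjoint; [exact: (op_par false i i p0)| |exact: (op_par false i i p1)| |].
  - exact: (subspaceZ (par_subspace M _)).
  - exact: (subspaceZ (par_subspace M _)).
  - by rewrite -scalerDr -yE -wy yE (lin_D ((op_action M).1 _ _ _)).
have [e|e] := eqVneq x0 0; last by exists false, x0; case: w01.
by exists true, x1; case: w01 => _ ?; split=> //; apply: contraNneq y0 => e'; rewrite yE e e' addr0.
Qed.

Definition I_list (n : nat) : seq idx := [seq I_enum k | k <- enum 'I_n].

Lemma I_list_uniq n : uniq (I_list n).
Proof. by rewrite map_inj_uniq ?enum_uniq //; exact: I_enum_inj. Qed.

Lemma mem_I_list n i : (i \in I_list n) = in_I n i.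
Proof.
apply/mapP/(I_enumP n) => [[k _ ->]|[k ->]]; first by exists k.
by exists k; rewrite ?mem_enum.
Qed.

(** The h_i with i in J are diagonalized one after the other among the vectors killed by
    c_n, on which h_i acts as h_i - h_j for any j outside J, that is, as the semisimple
    element of an sl(2). *)
Lemma weight_vector_exists : integrable M -> large_annihilator M -> (exists m : M, m != 0) ->
  exists (J : seq idx) f nu q, [/\ uniq J, f != 0, par q f, wt (@op K M) nu f &
    forall p a b, a \notin J -> b \notin J -> op p a b f = 0].
Proof.
move=> intM annM [m m0]; have HE := op_action M.
have [q [f0 [f0n pf0]]] : exists q (x : M), x != 0 /\ par q x.
  have [_ _ dec _] := par_grading M; have [x0 [x1 [p0 p1 mE]]] := dec m.
  have [e|e] := eqVneq x0 0; last by exists false, x0.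
  by exists true, x1; split=> //; apply: contraNneq m0 => e'; rewrite mE e e' addr0.
have [n _ ann] := annM f0; pose J := I_list n.
pose C (y : M) := par q y /\ forall p a b, a \notin J -> b \notin J -> op p a b y = 0.
have Cf0 : C f0.
  split=> // p a b; rewrite !mem_I_list => aJ bJ; apply: ann.
  by exists [:: (1, (p, a, b))]; rewrite /= aJ bJ big_seq1 scale1r.
suff H s : {subset s <= J} -> uniq s ->
    exists kap : idx -> int, exists f, [/\ C f, f != 0 & forall i, i \in s -> op false i i f = (kap i)%:~R *: f].
  have [kap [f [[pf kf] fn eig]]] := H J (fun _ => id) (I_list_uniq n).
  exists J, f, (fun i => if i \in J then kap i else 0), q; split=> //; first exact: I_list_uniq.
  by move=> i; have [iJ|iJ] := boolP (i \in J); [exact: eig|rewrite kf // scale0r].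
elim: s => [|i s IH] sJ /=; first by move=> _; exists (fun=> 0), f0.
case/andP=> is_ us; have [|kap [f [Cf fn eig]]] := IH _ us.
  by move=> x xs; apply: sJ; rewrite inE xs orbT.
have iJ : i \in J by apply: sJ; rewrite mem_head.
have [j jJ] := fresh J; have ij : i != j by rewrite (neqJ iJ jJ).
have ji : j != i by rewrite eq_sym.
have [ks hks] := torus_polynomial HE f ij (integrable_nilpotent intM ij) (integrable_nilpotent intM ji).
pose P y := C y /\ forall l, l \in s -> op false l l y = (kap l)%:~R *: y.
have hP k y : P y -> P ((op false i i y - op false j j y) - k *: y).
  move=> [[py ky] ey]; rewrite (ky _ j j) // subr0.
  have opB p a b c x z : op p a b (x - c *: z) = op p a b x - c *: op p a b z :> M.
    by rewrite (lin_D (HE.1 p a b)) -!scaleNr (lin_Z (HE.1 p a b)).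
  split; last by move=> l ls; rewrite opB op_torus ey // (lin_Z (HE.1 _ _ _)) scalerBr !scalerA mulrC.
  split.
    apply: (subspaceB (par_subspace M q)); last exact: (subspaceZ (par_subspace M q)).
    exact: (op_par false i i py).
  move=> p a b aJ bJ; rewrite opB HE.2 ky // (lin_0 (HE.1 _ _ _)) !scaler0 add0r subr0.
  by rewrite (neqJ' iJ bJ) (neqJ' iJ aJ) mulr0 !scale0r subr0.
have [y [Cy ey] [y0 [k hk]]] := eigenvector_exists hP (conj Cf eig) fn hks.
exists (fun l => if l == i then k else kap l), y; split=> // l.
rewrite inE; case: eqP => [-> _|_ /= ls]; last exact: ey.
by rewrite -hk (Cy.2 _ j j) // subr0.
Qed.

Theorem simple_is_highest_weight : in_Trep M -> simple_module M ->
  exists lam mu nu (p : nat) q v,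
    [/\ strict_partition lam, strict_partition mu,
        forall i, bip_weight K lam mu i = (nu i)%:~R,
        forall i : idx, p%:Z < `|val i| -> nu i = 0
      & [/\ v != 0, par q v & singular (@op K M) nu v]].
Proof.
move=> [intM _ annM] simM; have HE := op_action M.
have nilE i j : i != j -> locally_nilpotent (@op K M false i j) by exact: integrable_nilpotent.
have [J [f [nu0 [q0 [uJ f0 pf wf kf]]]]] := weight_vector_exists intM annM simM.1.
have [B hB] := weights_bounded HE nilE uJ (simple_generates simM pf f0) wf kf.
have [nu [[y y0 wy] [p outp] mono sgn_nu sing]] : exists nu, [/\ is_weight (@op K M) nu,
    exists p : nat, forall i : idx, p%:Z < `|val i| -> nu i = 0,
    forall i j, prec i j -> nu j <= nu i,
    forall i : idx, if 0 < val i then 0 <= nu i else nu i <= 0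
    & forall q i j y, prec i j -> wt (@op K M) nu y -> op q i j y = 0].
  apply: (maximal_weight HE nilE (B := B) (nu0 := nu0)); first by exists f.
  by move=> nu [y y0 wy]; exact: hB wy.
have sing' x : wt (@op K M) nu x -> singular (@op K M) nu x.
  by move=> wx; split=> // q i j ij; exact: sing wx.
have strict i j : prec i j -> nu i = nu j -> nu i = 0 by exact: (singular_strict HE nilE sing' y0 wy).
have [q [v [v0 pv wv]]] := homogeneous_weight y0 wy.
have posn k : k.+1%:Z != 0 by [].
have negn k : Negz k != 0 by [].
pose ip k : idx := exist _ k.+1%:Z (posn k).
pose im k : idx := exist _ (Negz k) (negn k).
have [lam slam lamE] : exists2 lam, strict_partition lam & forall k, nth 0%N lam k = `|nu (ip k)|%N.
  apply: strict_partition_of; first by exists p; rewrite outp //= ; lia.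
  move=> k nz; have pk : prec (ip k) (ip k.+1) by rewrite /prec /=; lia.
  have := mono _ _ pk; have := strict _ _ pk; have := sgn_nu (ip k.+1); rewrite /=; lia.
have [mu smu muE] : exists2 mu, strict_partition mu & forall k, nth 0%N mu k = `|nu (im k)|%N.
  apply: strict_partition_of; first by exists p; rewrite outp //= ; lia.
  move=> k nz; have pk : prec (im k.+1) (im k) by rewrite /prec /=; lia.
  have := mono _ _ pk; have := strict _ _ pk; have := sgn_nu (im k.+1); rewrite /=; lia.
exists lam, mu, nu, p, q, v; split=> //; last by split=> //; exact: sing'.
move=> i; rewrite /bip_weight; case iE: (val i) => [[|k]|k].
- by have := valP i; rewrite iE.
- have -> : i = ip k by apply: val_inj.
  by rewrite /= lamE; have := sgn_nu (ip k); rewrite /= => h; rewrite -[in RHS](gez0_abs h).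
- have -> : i = im k by apply: val_inj.
  rewrite muE; have := sgn_nu (im k); rewrite /= => h.
  by rewrite -[nu _ in RHS]opprK -(lez0_abs h) rmorphN.
Qed.

End Existence.

Section Uniqueness.
Variable K : numClosedFieldType.

Lemma Pi_simple (V : qmodule K) : simple_module V -> simple_module (Pi V).
Proof.
move=> [ex hV]; split=> // N [N0 Nl Ng Na]; apply: hV; split=> // m0 m1 p0 p1 h.
by have [] := Ng m1 m0 p1 p0; rewrite 1?addrC.
Qed.

Lemma pure_singular (V : qmodule K) nu s q (v : V) : uniq s -> (forall i, i \in s -> nu i != 0) ->
  v != 0 -> par q v -> singular (@op K V) nu v ->
  exists r (u : V), [/\ u != 0, par r u, singular (@op K V) nu u & pure (@op K V) nu s u].
Proof.
move=> us ns v0 pv sv; have HE := op_action V.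
have [] := @pure_exists _ _ _ HE nu (fun u : V => singular (@op K V) nu u /\ exists r, par r u) s v => //.
- by move=> z [].
- move=> i j z [sz [r pz]]; split; first exact: psi_sing.
  exists (true (+) r); apply: (subspaceB (par_subspace V _)); first exact: op_par.
  by apply: (subspaceZ (par_subspace V _)); exact: op_par.
- by split=> //; exists q.
- by move=> u [u0 [su [r pu]] hu]; exists r, u.
Qed.

(** Both highest weight spaces contain a pure vector for the indices where the weight
    does not vanish; replacing V by Pi V makes their parities equal. *)
Theorem highest_weight_unique (M V : qmodule K) (lam mu : seq nat) nu (p : nat) q (v : M) :
  simple_module M -> v != 0 -> par q v -> singular (@op K M) nu v ->
  (forall i, bip_weight K lam mu i = (nu i)%:~R) ->
  (forall i : idx, p%:Z < `|val i| -> nu i = 0) ->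
  is_V lam mu V -> isomorphic M V \/ isomorphic M (Pi V).
Proof.
move=> sM v0 pv sv nuE outp [sV [q' [v' [[v0' pv'] nv' wv' _]]]].
have sv' : singular (@op K V) nu v'.
  split=> [i|r i j ij]; first by rewrite /op wv' nuE.
  by apply: nv'; exists [:: (1, (r, i, j))]; rewrite /= ij big_seq1 scale1r.
pose s := [seq i <- I_list p.*2 | nu i != 0].
have us : uniq s by apply/filter_uniq/I_list_uniq.
have sP i : (i \in s) = (nu i != 0).
  rewrite mem_filter mem_I_list; apply: andb_idr => ni.
  have : `|val i| <= p%:Z by rewrite leNgt; apply/negP => /outp /eqP; rewrite (negbTE ni).
  rewrite /in_I uphalf_double doubleK. case: i ni => i i0 _ /=. lia.
have ns i : i \in s -> nu i != 0 by rewrite sP.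
have [r [u [u0 pu su hu]]] := pure_singular us ns v0 pv sv.
have [r' [u' [u0' pu' su' hu']]] := pure_singular us ns v0' pv' sv'.
have [rr|rr] := eqVneq r r'.
  left; rewrite -{}rr in pu'.
  exact: (pure_isomorphism sM sV pu pu' u0 u0' us sP su su' hu hu').
right; have pu'' : @par K (Pi V) r u' by move: rr pu'; rewrite /=; case: (r); case: (r').
exact: (@pure_isomorphism K M (Pi V) r u u' nu s sM (Pi_simple sV) pu pu'' u0 u0' us sP su su' hu hu').
Qed.

Theorem trep_simple_classification (M : qmodule K) :
  in_Trep M -> simple_module M ->
  exists lam mu : seq nat,
    [/\ strict_partition lam, strict_partition mu,
        exists V : qmodule K, is_V lam mu V
      & forall V : qmodule K, is_V lam mu V ->
          isomorphic M V \/ isomorphic M (Pi V)].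
Proof.
move=> tM sM; have [lam [mu [nu [p [q [v [slam smu nuE outp [v0 pv sv]]]]]]]] := simple_is_highest_weight tM sM.
exists lam, mu; split=> // [|V hV]; last exact: (highest_weight_unique sM v0 pv sv nuE outp hV).
exists M; split=> //; exists q, v; split=> //.
- move=> X [s [/allP sprec ->]]; elim: s sprec => [|t s IH] sprec; first by rewrite big_nil act0l.
  rewrite big_cons act_linl IH ?addr0 => [|x xs]; last by apply: sprec; rewrite inE xs orbT.
  have := sv.2 t.2.1.1 _ _ (sprec t (mem_head _ _)); rewrite /op => ->; exact: scaler0.
- by move=> i; rewrite nuE; exact: sv.1.
- by move=> N hN Nv; have [/(_ v Nv) e|//] := sM.2 N hN; rewrite e eqxx in v0.
Qed.

End Uniqueness.

Theorem lemma3p10 (R : realType) (M : qmodule R[i]) :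
  in_Trep M -> simple_module M ->
  exists lam mu : seq nat,
    [/\ strict_partition lam, strict_partition mu,
        exists V : qmodule R[i], is_V lam mu V
      & forall V : qmodule R[i], is_V lam mu V ->
          isomorphic M V \/ isomorphic M (Pi V)].
Proof. exact: (@trep_simple_classification R[i] M). Qed.
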